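(* Assume $\lambda_1(-L)\in\sigma_{disc}(-L)$, and that there exists $\kappa>0$ such that the function $W=\frac{V''}{2}+\frac{(V')^2}{4}$ satisfies $W''(x)\ge2\kappa^2$ for all $x\in\mathbb R$. Then $$\lambda_2(-L)-\lambda_1(-L)\ \ge\ 2\kappa .$$
   Context: $V\in C^\infty(\mathbb R)$ with $\int e^{-V}dx<\infty$, $\mu$ the probability measure with density proportional to $e^{-V}$, $Lf=f''-V'f'$ self-adjoint in $L^2(\mu)$ (unique extension from $C_0^\infty(\mathbb R)$). $\sigma_{disc}(-L)$ is the set of isolated eigenvalues of finite multiplicity. For $n\ge1$, $\lambda_n(-L)=\sup_{g_0,\dots,g_{n-1}\in L^2(\mu)}\inf_{f\in D(-L)\setminus\{0\},\,f\perp_\mu g_i}\frac{\int f(-Lf)\,d\mu}{\int f^2d\mu}$ (max-min values; $\lambda_1(-L)$ is the spectral gap, and $\lambda_2(-L)$ may be the bottom of the essential spectrum). *)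

(* Defs.v *)
From HB Require Import structures.
From mathcomp Require Import all_boot all_order all_algebra.
From mathcomp Require Import all_classical all_reals all_analysis.
Set Implicit Arguments. Unset Strict Implicit. Unset Printing Implicit Defensive.
Import Order.TTheory GRing.Theory Num.Theory.
Import numFieldNormedType.Exports.
Local Open Scope classical_set_scope.
Local Open Scope ring_scope.

Section Spectral.
Variable R : realType.
Implicit Types (V f g h : R -> R).

Definition smooth f := forall (n : nat) (x : R), derivable (derive1n n f) x 1.

Definition compact_supp f := exists a b : R, forall x, (x < a \/ b < x) -> f x = 0.

Definition Cc_inf f := smooth f /\ compact_supp f.

Definition wt V (x : R) : R := expR (- V x).

Definition Zc V : R := Rintegral (@lebesgue_measure R) setT (wt V).

Definition L2 V f := measurable_fun setT f /\
  (\int[@lebesgue_measure R]_x (((f x) ^+ 2 * wt V x)%:E) < +oo)%E.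

Definition ip V f g : R :=
  Rintegral (@lebesgue_measure R) setT (fun x => f x * g x * wt V x) / Zc V.

Definition nrm2 V f : R := ip V f f.

Definition Lop V f : R -> R := fun x => derive1n 2 f x - derive1 V x * derive1 f x.

(* graph of the closure of L restricted to C_0^infinity (= the unique
   self-adjoint extension): f in D(L) and L f = g *)
Definition closL V f g := L2 V f /\ L2 V g /\
  exists phi : nat -> R -> R, (forall k, Cc_inf (phi k)) /\
    ((fun k => nrm2 V (fun x => phi k x - f x)) @ \oo --> (0 : R)) /\
    ((fun k => nrm2 V (fun x => Lop V (phi k) x - g x)) @ \oo --> (0 : R)).

Definition lam V (n : nat) : \bar R :=
  ereal_sup [set v : \bar R | exists gs : nat -> R -> R,
    (forall i, (i < n)%N -> L2 V (gs i)) /\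
    v = ereal_inf [set w : \bar R | exists f g, closL V f g /\ nrm2 V f != 0 /\
          (forall i, (i < n)%N -> ip V f (gs i) = 0) /\
          w = ((- ip V f g) / nrm2 V f)%:E]].

Definition resolvent V (t : R) := exists C : R,
  (forall h, L2 V h -> exists f g, closL V f g /\
      nrm2 V (fun x => - g x - t * f x - h x) = 0) /\
  (forall f g, closL V f g -> nrm2 V f <= C * nrm2 V (fun x => - g x - t * f x)).

Definition eigfun V (t : R) f := exists g, closL V f g /\
  nrm2 V (fun x => g x + t * f x) = 0.

Definition disc_spec V (t : R) :=
  (exists f, eigfun V t f /\ nrm2 V f != 0) /\
  (exists (N : nat) (e : 'I_N -> R -> R), (forall i, eigfun V t (e i)) /\
     forall f, eigfun V t f -> exists a : 'I_N -> R,
       nrm2 V (fun x => f x - \sum_(i < N) a i * e i x) = 0) /\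
  (exists eps : R, 0 < eps /\
     forall s : R, 0 < `|s - t| < eps -> resolvent V s).

Definition Wfun V : R -> R := fun x => derive1n 2 V x / 2 + (derive1 V x) ^+ 2 / 4.

End Spectral.

(* Main.v *)
(** Up to unitary equivalence - L = A^* A, and the partner A A^* is the Schroedinger operator
    - d^2/dx^2 + W, whose spectrum is that of - L without 0. If f1 is the eigenfunction of
    lambda_1 = r, then psi = f1' e^(-V/2) is an eigenfunction of the partner for r, and it has no
    zero: at a zero a of f1' the functions f1 - f1(a), cut off on either side of a, have Rayleigh
    quotient below r, so that r would not be the spectral gap. Hence A A^* = D^* D + r with
    D = d/dx + h and h = - psi'/psi, where h' = h^2 - W + r. Comparing psi with Gaussians through
    a Wronskian shows h' >= kappa, so D D^* = D^* D + 2 h' >= 2 kappa. Factorizing twice,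
    - L >= r + 2 kappa on the orthogonal complement of 1 and f1. That r > 0 follows from W >= 1
    outside a compact set together with the finiteness of the integral of e^(-V). *)

Require Import Defs.
From HB Require Import structures.
From mathcomp Require Import all_boot all_order all_algebra.
From mathcomp Require Import all_classical all_reals all_analysis measurable_realfun.
From mathcomp Require Import ring lra.
Set Implicit Arguments. Unset Strict Implicit. Unset Printing Implicit Defensive.
Import Order.TTheory GRing.Theory Num.Theory.
Import numFieldNormedType.Exports.
Local Open Scope classical_set_scope.
Local Open Scope ring_scope.

(** * Integrals and derivatives on the line *)

Section Integrals.
Variable R : realType.
Notation mu := (@lebesgue_measure R).
Implicit Types (f g F G : R -> R) (a b c x y : R).

(** The domain of L is accessible only through limits of test functions, so neither partner
    operators nor a spectral theorem appear: each factorization is an identity between integrals of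
    compactly supported functions whose integrands differ by a derivative. A test function
    approximating a domain element is smooth but violates the orthogonality constraints, and its
    repaired version satisfies them but is merely continuous. Lower bounds for [lam] therefore start
    from an inequality pairing the two, and writing [f * wt] as a derivative [z'] carries this
    inequality to the partner. The eigenvalue equation is kept as a first-order system for [F] and
    [P = wt * F'], since [P] is a ray integral and passes to [L2] limits uniformly. The constant is
    that of the harmonic oscillator: for V = kappa x^2 the function [Wfun V] is kappa + kappa^2 x^2,
    and the eigenvalues are the multiples of 2 kappa. Its Gaussian ground state is also the
    comparison function for psi. *)

Definition integrableR f := mu.-integrable setT (EFin \o f).
Definition intR f : R := Rintegral mu setT f.
Definition cc f := continuous f /\ compact_supp f.
Definition has_deriv F f := forall x, is_derive x (1 : R) F (f x).

Lemma integrableR_ext f g : f =1 g -> integrableR f -> integrableR g.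
Proof. by move=> /funext ->. Qed.

Lemma intR_ext f g : f =1 g -> intR f = intR g.
Proof. by move=> /funext ->. Qed.

Lemma integrableRD f g : integrableR f -> integrableR g ->
  integrableR (fun x => f x + g x).
Proof. by move=> hf hg; exact: (integrableD measurableT hf hg). Qed.

Lemma integrableRZ c f : integrableR f -> integrableR (fun x => c * f x).
Proof. by move=> hf; exact: (integrableZl measurableT c hf). Qed.

Lemma integrableRB f g : integrableR f -> integrableR g ->
  integrableR (fun x => f x - g x).
Proof. by move=> hf hg; exact: (integrableB measurableT hf hg). Qed.

Lemma intRD f g : integrableR f -> integrableR g ->
  intR (fun x => f x + g x) = intR f + intR g.
Proof. by move=> hf hg; exact: RintegralD. Qed.

Lemma intRB f g : integrableR f -> integrableR g ->
  intR (fun x => f x - g x) = intR f - intR g.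
Proof. by move=> hf hg; exact: RintegralB. Qed.

Lemma intRZ c f : integrableR f -> intR (fun x => c * f x) = c * intR f.
Proof. by move=> hf; exact: RintegralZl. Qed.

Lemma intR_ge0 f : (forall x, 0 <= f x) -> 0 <= intR f.
Proof. by move=> h; apply: Rintegral_ge0. Qed.

Lemma le_intR f g : integrableR f -> integrableR g -> (forall x, f x <= g x) ->
  intR f <= intR g.
Proof. by move=> hf hg h; apply: le_Rintegral. Qed.

Lemma normr_intR f : integrableR f -> `|intR f| <= intR (fun x => `|f x|).
Proof. by move=> hf; apply: le_normr_Rintegral. Qed.

Lemma integrableR_measurable f : integrableR f -> measurable_fun setT f.
Proof. by move=> /integrableP[/measurable_EFinP]. Qed.

Lemma le_integrableR f g : measurable_fun setT f ->
  (forall x, `|f x| <= g x) -> integrableR g -> integrableR f.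
Proof.
move=> mf fg ig; apply: (le_integrable measurableT _ _ ig).
  exact/measurable_EFinP.
by move=> x _ /=; rewrite lee_fin (le_trans (fg x))// ler_norm.
Qed.

Lemma integrableR_norm f : integrableR f -> integrableR (fun x => `|f x|).
Proof. by move=> h; exact: integrable_norm. Qed.

Lemma measurable_cont f : continuous f -> measurable_fun setT f.
Proof. exact: continuous_measurable_fun. Qed.

Lemma cc_restrict f : cc f -> exists a b, a < b /\
  (forall x, (x < a \/ b < x) -> f x = 0) /\ f \_ `[a, b] = f.
Proof.
(* [compact_supp] permits endpoints in the wrong order; sorting them and moving the right one by 1
   gives a nondegenerate interval. *)
move=> [cf [a [b h]]]; exists (Order.min a b), (Order.max a b + 1).
have h' : forall x : R, x < Order.min a b \/ Order.max a b + 1 < x -> f x = 0.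
  move=> x [hx|hx]; apply: h.
    by left; rewrite (lt_le_trans hx)// ge_min lexx.
  right; apply: le_lt_trans hx.
  by rewrite -[leLHS]addr0 lerD// le_max lexx orbT.
split; last split => //.
  apply: (@le_lt_trans _ _ (Order.max a b)); last by rewrite ltrDl.
  by rewrite ge_min le_max lexx.
apply/funext => x; rewrite patchE; case: ifPn => // /negP hx.
rewrite h'//; have [lt|ge] := ltP x (Order.min a b); first by left.
right; rewrite ltNge; apply/negP => le; apply: hx.
by rewrite inE/= in_itv/= ge le.
Qed.

Lemma integrable_cc f : cc f -> integrableR f.
Proof.
move=> hf; have [a [b [ab [h e]]]] := cc_restrict hf.
rewrite /integrableR -e -restrict_EFin.
apply/integrable_restrict => //=.
rewrite setTI; apply: continuous_compact_integrable.
  exact: segment_compact.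
by apply: continuous_subspaceT; case: hf.
Qed.

Lemma has_deriv_cont F f : has_deriv F f -> continuous F.
Proof.
move=> h x; apply/differentiable_continuous/derivable1_diffP.
by have [] := h x.
Qed.

Lemma ftc_itv F f a b : a <= b -> has_deriv F f -> continuous f ->
  intR (f \_ `[a, b]) = F b - F a.
Proof.
move=> ab hF cf; rewrite /intR -Rintegral_mkcond.
move: ab; rewrite le_eqVlt => /predU1P[<-|ab].
  by rewrite set_itv1 Rintegral_set1 subrr.
rewrite /Rintegral (@continuous_FTC2 _ f F)//.
- exact: continuous_subspaceT.
- have cF := has_deriv_cont hF; split.
  + by move=> x _; have [] := hF x.
  + by apply: cvg_at_right_filter; exact: cF.
  + by apply: cvg_at_left_filter; exact: cF.
- by move=> x _; rewrite derive1E; have [_ ->] := hF x.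
Qed.

Lemma integrable_itv f a b : continuous f -> integrableR (f \_ `[a, b]).
Proof.
move=> cf; rewrite /integrableR -restrict_EFin.
apply/integrable_restrict => //=.
rewrite setTI; apply: continuous_compact_integrable; first exact: segment_compact.
exact: continuous_subspaceT.
Qed.

Lemma ftc_cc F f a b : a <= b -> has_deriv F f -> continuous f ->
  (forall x, x < a \/ b < x -> f x = 0) -> intR f = F b - F a.
Proof.
move=> ab hF cf h; rewrite -(ftc_itv ab hF cf); apply: intR_ext => x.
rewrite patchE; case: ifPn => // /negP hx; apply: h.
have [lt|ge] := ltP x a; first by left.
right; rewrite ltNge; apply/negP => le; apply: hx.
by rewrite inE/= in_itv/= ge le.
Qed.

(** The integrations by parts below take this form: the difference of two integrands is recognized
    as the derivative of a compactly supported function. *)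
Lemma intR_deriv0 F f : has_deriv F f -> cc f -> compact_supp F -> intR f = 0.
Proof.
move=> hF hf [a [b h]]; have [a' [b' [ab' [h' _]]]] := cc_restrict hf.
pose A := Order.min a a' - 1; pose B := Order.max b b' + 1.
have Aa : A < a.
   rewrite /A; have : Order.min a a' <= a by rewrite ge_min lexx.
  lra.
have Aa' : A < a'.
   rewrite /A; have : Order.min a a' <= a' by rewrite ge_min lexx orbT.
  lra.
have bB : b < B.
   rewrite /B; have : b <= Order.max b b' by rewrite le_max lexx.
  lra.
have b'B : b' < B.
   rewrite /B; have : b' <= Order.max b b' by rewrite le_max lexx orbT.
  lra.
rewrite (@ftc_cc F f A B) ?h ?subrr//; [by left|by right| |by case: hf|].
  exact/ltW/(lt_trans Aa')/(lt_trans ab').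
by move=> x [hx|hx]; apply: h'; [left; exact: (lt_trans hx)|right; exact: (lt_trans b'B)].
Qed.

Lemma ftc_ray F f x : has_deriv F f -> cc f -> compact_supp F ->
  intR (f \_ `]-oo, x]) = F x.
Proof.
move=> hF hf [a [b h]]; have [a' [b' [_ [h' _]]]] := cc_restrict hf.
pose m := Num.min (Num.min a a') x; pose A := m - 1.
have ma : m <= a by rewrite /m !ge_min lexx.
have ma' : m <= a' by rewrite /m !ge_min lexx orbT.
have mx : m <= x by rewrite /m ge_min lexx orbT.
have Ax : A <= x by rewrite /A; lra.
have -> : F x = F x - F A by rewrite (h A) ?subr0//; left; rewrite /A; lra.
rewrite -(ftc_itv Ax hF); last by case: hf.
apply: intR_ext => t; rewrite !patchE !mem_setE !in_itv/= andbC.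
case: (leP t x) => //= _; case: (leP A t) => // tA.
by apply: h'; left; rewrite /A in tA; lra.
Qed.

(** Primitives on the intervals [|x| < n + 1], normalized to vanish at 0, agree on overlaps by the
    mean value theorem and are glued together. *)
Lemma primitive_exists f : continuous f -> exists F, has_deriv F f.
Proof.
move=> cf.
have loc (n : nat) : exists F, F 0 = 0 /\ forall x, `|x| < n.+1%:R -> is_derive x (1 : R) F (f x).
  pose G x := \int[mu]_(t in `[- n.+1%:R, x]) f t.
  have hG x : `|x| < n.+1%:R -> is_derive x (1 : R) G (f x).
    rewrite ltr_norml => /andP[h1 h2].
    have ifn : mu.-integrable `[- n.+1%:R, n.+1%:R] (EFin \o f).
      apply: continuous_compact_integrable; first exact: segment_compact.
      exact: continuous_subspaceT.
    have [dG G'] := @continuous_FTC1_closed _ f (- n.+1%:R) x n.+1%:R h2 ifn h1 (cf x).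
    apply: DeriveDef; first exact: dG.
    by rewrite -derive1E; exact: G'.
  exists (fun x => G x - G 0); split; first by rewrite subrr.
  move=> x hx; have := hG x hx => hGx.
  by apply: is_derive_eq; rewrite subr0.
pose F n := sval (cid (loc n)).
have F0 n : F n 0 = 0 by rewrite /F; case: cid => ? [].
have F' n x : `|x| < n.+1%:R -> is_derive x (1 : R) (F n) (f x).
  by rewrite /F; case: cid => g [_ /=]; apply.
have Feq n m x : (n <= m)%N -> `|x| < n.+1%:R -> F n x = F m x.
  move=> nm hx; apply/eqP; rewrite -subr_eq0; apply/eqP.
  pose D y := F n y - F m y.
  have D' y : `|y| < n.+1%:R -> is_derive y (1 : R) D 0.
    move=> hy; have h1 := F' n y hy.
    have h2 : is_derive y (1 : R) (F m) (f y).
      by apply: F'; apply: (lt_le_trans hy); rewrite ler_nat.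
    by apply: is_derive_eq; rewrite subrr.
  rewrite -/(D x); have D0 : D 0 = 0 by rewrite /D !F0 subrr.
  move: hx; rewrite ltr_norml => /andP[h1 h2].
  have itv a b y : - n.+1%:R < a -> b < n.+1%:R -> a <= y <= b -> `|y| < n.+1%:R.
    move=> ha hb /andP[ay yb]; rewrite ltr_norml.
    by rewrite (lt_le_trans ha)// (le_lt_trans yb).
  case: (ltrgtP x 0) => [x0|x0|->//].
  - have [||c _ /eqP] := @MVT R D (fun=> 0) x 0 x0.
    + move=> y; rewrite in_itv/= => /andP[/ltW hy1 /ltW hy2].
      by apply: D'; apply: (itv x 0) => //; rewrite hy1.
    + apply: derivable_within_continuous => y; rewrite in_itv/= => hy.
      by have [] := D' y (itv x 0 y h1 (ltr0Sn _ _) hy).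
    + by rewrite mul0r D0 sub0r oppr_eq0 => /eqP.
  - have [||c _ /eqP] := @MVT R D (fun=> 0) 0 x x0.
    + move=> y; rewrite in_itv/= => /andP[/ltW hy1 /ltW hy2].
      apply: D'; apply: (itv 0 x) => //; last by rewrite hy1.
    + apply: derivable_within_continuous => y; rewrite in_itv/= => hy.
      have h0 : - n.+1%:R < 0 :> R by rewrite ltrNl oppr0 ltr0Sn.
      by have [] := D' y (itv 0 x y h0 h2 hy).
    + by rewrite mul0r D0 subr0 => /eqP.
pose N x := Num.trunc `|x|.
have hN x : `|x| < (N x).+1%:R by rewrite /N; exact: Num.Theory.truncnS_gt.
exists (fun x => F (N x) x) => x.
(* The index [N] may jump near [x]. On the neighbourhood [|y| < m] it is at most [m], so the single
   primitive [F m] represents the glued function there. *)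
pose m := (N x).+1.
have xm : `|x| < m.+1%:R by apply: (lt_trans (hN x)); rewrite ltr_nat.
apply: (near_eq_is_derive _ (F' m x xm)).
have hn : \near x, `|x| < m%:R.
  exact: (cvgr_lt _ (@norm_continuous _ _ x) _ (hN x)).
apply: filterS hn => y hy; apply/esym; apply: Feq (hN y).
by rewrite ltnW// Num.Theory.truncn_lt_nat.
Qed.
Lemma cc_ext f g : f =1 g -> cc f -> cc g.
Proof. by move=> /funext ->. Qed.

Lemma ccM f g : continuous f -> cc g -> cc (fun x => f x * g x).
Proof.
move=> cf [cg [a [b h]]]; split.
  by move=> x; apply: continuousM; [exact: cf|exact: cg].
by exists a, b => x /h ->; rewrite mulr0.
Qed.

Lemma cc_cont f : cc f -> continuous f. Proof. by case. Qed.

Lemma ccMr f g : cc f -> continuous g -> cc (fun x => f x * g x).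
Proof.
by move=> hf cg; apply: (@cc_ext (fun x => g x * f x)); [move=> x; exact: mulrC|exact: ccM].
Qed.

Lemma ccX2 f : cc f -> cc (fun x => f x ^+ 2).
Proof.
move=> hf; apply: (@cc_ext (fun x => f x * f x)); first by move=> x; rewrite expr2.
by apply: ccM => //; exact: cc_cont.
Qed.

Lemma ccZ c f : cc f -> cc (fun x => c * f x).
Proof. by move=> hf; apply: ccM => // x; exact: cvg_cst. Qed.

Lemma cc0 : cc (fun=> 0).
Proof. by split; [move=> x; exact: cvg_cst|exists 0, 0]. Qed.

Lemma compact_suppD f g : compact_supp f -> compact_supp g ->
  compact_supp (fun x => f x + g x).
Proof.
move=> [a [b h]] [a' [b' h']]; exists (Order.min a a'), (Order.max b b') => x.
rewrite lt_min gt_max => -[/andP[h1 h2]|/andP[h1 h2]].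
  by rewrite h ?h' ?addr0//; left.
by rewrite h ?h' ?addr0//; right.
Qed.

Lemma ccD f g : cc f -> cc g -> cc (fun x => f x + g x).
Proof.
move=> [cf sf] [cg sg]; split; last exact: compact_suppD.
by move=> x; apply: continuousD; [exact: cf|exact: cg].
Qed.

Lemma ccB f g : cc f -> cc g -> cc (fun x => f x - g x).
Proof.
move=> hf hg; apply: (@cc_ext (fun x => f x + (-1) * g x)).
  by move=> x; rewrite mulN1r.
by apply: ccD => //; exact: ccZ.
Qed.

Lemma cc_sum n (h : 'I_n -> R -> R) : (forall i, cc (h i)) -> cc (fun x => \sum_(i < n) h i x).
Proof.
elim: n h => [|n IH] h hh.
  by apply: (@cc_ext (fun=> 0)); [move=> x; rewrite big_ord0|exact: cc0].
apply: (@cc_ext (fun x => \sum_(i < n) h (widen_ord (leqnSn n) i) x + h ord_max x)).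
  by move=> x; rewrite big_ord_recr.
by apply: ccD => //; exact: IH.
Qed.

Lemma compact_supp_deriv F f : has_deriv F f -> compact_supp F -> compact_supp f.
Proof.
move=> hF [a [b h]]; exists a, b => x hx.
suff h0 : is_derive x (1 : R) F 0 by have [_ <-] := hF x; have [_ ->] := h0.
apply: (@near_eq_is_derive _ _ _ (cst 0)).
  case: hx => hx.
    by near=> y; rewrite h//; left; near: y; exact: lt_nbhsl.
  by near=> y; rewrite h//; right; near: y; exact: lt_nbhsr.
Unshelve. all: end_near.
Qed.

Lemma cc_deriv F f : has_deriv F f -> continuous f -> compact_supp F -> cc f.
Proof. by move=> hF cf sF; split => //; exact: compact_supp_deriv sF. Qed.

Lemma smooth_deriv f : smooth f -> has_deriv f (derive1 f).
Proof. by move=> sf x; rewrite derive1E; apply/derivableP; exact: (sf 0%N). Qed.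

Lemma smooth_derive1 f : smooth f -> smooth (derive1 f).
Proof.
move=> sf n x; have := sf n.+1 x.
by rewrite /derive1n iterSr.
Qed.

Lemma has_deriv_eq F f G g : has_deriv F f -> F =1 G -> f =1 g -> has_deriv G g.
Proof. by move=> h /funext <- /funext <-. Qed.

Lemma has_derivM F f G g : has_deriv F f -> has_deriv G g ->
  has_deriv (fun x => F x * G x) (fun x => f x * G x + F x * g x).
Proof.
move=> hF hG x; have H1 := hF x; have H2 := hG x; apply: is_derive_eq.
by rewrite /GRing.scale/=; ring.
Qed.

Lemma has_derivD F f G g : has_deriv F f -> has_deriv G g ->
  has_deriv (fun x => F x + G x) (fun x => f x + g x).
Proof. by move=> hF hG x; exact: is_deriveD. Qed.

Lemma has_deriv_cst c : has_deriv (fun=> c) (fun=> 0).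
Proof. by move=> x; exact: is_derive_cst. Qed.

Lemma has_deriv_id : has_deriv id (fun=> 1).
Proof. by move=> x; exact: is_derive_id. Qed.

Lemma has_derivZ c F f : has_deriv F f -> has_deriv (fun x => c * F x) (fun x => c * f x).
Proof.
move=> hF; apply: has_deriv_eq (has_derivM (has_deriv_cst c) hF) _ _ => // x.
by rewrite mul0r add0r.
Qed.

Lemma has_derivX2 F f : has_deriv F f -> has_deriv (fun x => F x ^+ 2) (fun x => 2 * F x * f x).
Proof.
move=> hF; apply: has_deriv_eq (has_derivM hF hF) _ _ => x; first by rewrite expr2.
by ring.
Qed.

Lemma has_deriv_comp F f G g : has_deriv F f -> has_deriv G g ->
  has_deriv (fun x => F (G x)) (fun x => f (G x) * g x).
Proof. by move=> hF hG x; exact: (@is_derive1_comp R F G x _ _ (hF (G x)) (hG x)). Qed.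

Lemma has_deriv_expR F f : has_deriv F f ->
  has_deriv (fun x => expR (F x)) (fun x => f x * expR (F x)).
Proof.
move=> hF; have he : has_deriv (@expR R) (@expR R) by move=> x; exact: is_derive_expR.
by apply: has_deriv_eq (has_deriv_comp he hF) _ _ => // x; exact: mulrC.
Qed.

Lemma has_derivV F f : has_deriv F f -> (forall x, F x != 0) ->
  has_deriv (fun x => (F x)^-1) (fun x => - f x / F x ^+ 2).
Proof.
move=> hF h x; have := is_deriveV (h x) (hF x).
by rewrite /GRing.scale/= mulrC mulrN mulNr.
Qed.

Lemma has_deriv_derive1 F f : has_deriv F f -> derive1 F = f.
Proof. by move=> hF; apply/funext => x; rewrite derive1E; have [_ ->] := hF x. Qed.

Lemma contM f g : continuous f -> continuous g -> continuous (fun x => f x * g x).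
Proof. by move=> cf cg x; apply: continuousM; [exact: cf|exact: cg]. Qed.

Lemma contD f g : continuous f -> continuous g -> continuous (fun x => f x + g x).
Proof. by move=> cf cg x; apply: continuousD; [exact: cf|exact: cg]. Qed.

Lemma contZ c f : continuous f -> continuous (fun x => c * f x).
Proof. by move=> cf; apply: contM => // x; exact: cvg_cst. Qed.

Lemma contX2 f : continuous f -> continuous (fun x => f x ^+ 2).
Proof.
by move=> cf; rewrite (_ : (fun x => _) = fun x => f x * f x); [exact: contM|apply/funext => x; rewrite expr2].
Qed.

(** [Ck n] means [n + 1] times differentiable. Derivatives of products and compositions involve the
    original factors again, so closure of [smooth] is proved by induction on this level, for all
    functions at once. *)
Definition Ck n f := forall k, (k <= n)%N -> forall x, derivable (derive1n k f) x 1.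

Lemma smoothP f : smooth f <-> forall n, Ck n f.
Proof. by split=> [h n k _ x|h n x]; [exact: h|exact: (h n n (leqnn n))]. Qed.

Lemma Ck_deriv n F f : has_deriv F f -> Ck n f -> Ck n.+1 F.
Proof.
move=> hF hf [_ x|k]; first by have [] := hF x.
by rewrite ltnS => kn x; rewrite /derive1n iterSr (has_deriv_derive1 hF); exact: hf.
Qed.

Lemma Ck_0 F f : has_deriv F f -> Ck 0 F.
Proof. by move=> hF k; rewrite leqn0 => /eqP -> x; have [] := hF x. Qed.

Lemma Ck_has_deriv n f : Ck n f -> has_deriv f (derive1 f).
Proof. by move=> h x; rewrite derive1E; apply/derivableP; exact: (h 0%N). Qed.

Lemma Ck_derive1 n f : Ck n.+1 f -> Ck n (derive1 f).
Proof. by move=> h k kn x; have := h k.+1 kn x; rewrite /derive1n iterSr. Qed.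

Lemma Ck_le n m f : (n <= m)%N -> Ck m f -> Ck n f.
Proof. by move=> nm h k kn; apply: h; exact: leq_trans nm. Qed.

Lemma CkD n f g : Ck n f -> Ck n g -> Ck n (fun x => f x + g x).
Proof.
elim: n f g => [|n IH] f g hf hg.
  exact: (Ck_0 (has_derivD (Ck_has_deriv hf) (Ck_has_deriv hg))).
apply: (Ck_deriv (has_derivD (Ck_has_deriv hf) (Ck_has_deriv hg))).
exact: (IH _ _ (Ck_derive1 hf) (Ck_derive1 hg)).
Qed.

Lemma CkM n f g : Ck n f -> Ck n g -> Ck n (fun x => f x * g x).
Proof.
elim: n f g => [|n IH] f g hf hg.
  exact: (Ck_0 (has_derivM (Ck_has_deriv hf) (Ck_has_deriv hg))).
apply: (Ck_deriv (has_derivM (Ck_has_deriv hf) (Ck_has_deriv hg))).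
have lef := Ck_le (leqnSn n) hf; have leg := Ck_le (leqnSn n) hg.
exact: (CkD (IH _ _ (Ck_derive1 hf) leg) (IH _ _ lef (Ck_derive1 hg))).
Qed.

Lemma Ck_cst n c : Ck n (fun=> c).
Proof.
elim: n c => [|n IH] c; first exact: Ck_0 (has_deriv_cst c).
exact: Ck_deriv (has_deriv_cst c) (IH 0).
Qed.

Lemma smoothD f g : smooth f -> smooth g -> smooth (fun x => f x + g x).
Proof. by move=> /smoothP hf /smoothP hg; apply/smoothP => n; exact: CkD. Qed.

Lemma smoothM f g : smooth f -> smooth g -> smooth (fun x => f x * g x).
Proof. by move=> /smoothP hf /smoothP hg; apply/smoothP => n; exact: CkM. Qed.

Lemma smooth_cst c : smooth (fun=> c).
Proof. by apply/smoothP => n; exact: Ck_cst. Qed.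

Lemma smoothB f g : smooth f -> smooth g -> smooth (fun x => f x - g x).
Proof.
move=> hf hg; have h := smoothD hf (smoothM (@smooth_cst (-1)) hg).
by rewrite (_ : (fun x => _) = fun x => f x + (-1 : R) * g x)//; apply/funext => x; rewrite mulN1r.
Qed.

Lemma smooth_expR f : smooth f -> smooth (fun x => expR (f x)).
Proof.
move=> sf; have h := has_deriv_expR (smooth_deriv sf).
apply/smoothP; elim=> [|n IH]; first exact: Ck_0 h.
have /smoothP s1 := smooth_derive1 sf.
exact: (Ck_deriv h (CkM (s1 n) IH)).
Qed.

Lemma smooth_affine f a b : smooth f -> smooth (fun x => f (a * x + b)).
Proof.
move=> /smoothP sf; apply/smoothP => n.
have ha : has_deriv (fun x => a * x + b) (fun=> a).
  apply: has_deriv_eq (has_derivD (has_derivZ a has_deriv_id) (has_deriv_cst b)) _ _ => // x.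
  by rewrite mulr1 addr0.
elim: n f sf => [|n IH] f sf.
  exact: Ck_0 (has_deriv_comp (Ck_has_deriv (sf 0%N)) ha).
apply: (Ck_deriv (has_deriv_comp (Ck_has_deriv (sf 0%N)) ha)).
refine (CkM (IH _ _) (@Ck_cst n a)) => m.
exact: (Ck_derive1 (sf m.+1)).
Qed.

Lemma smooth_primitive F f : has_deriv F f -> smooth f -> smooth F.
Proof.
move=> hF /smoothP sf; apply/smoothP => -[|n]; first exact: Ck_0 hF.
exact: Ck_deriv hF (sf n).
Qed.

Lemma smooth_deriv2 f : smooth f -> has_deriv (derive1 f) (derive1n 2 f).
Proof. by move=> sf; exact: smooth_deriv (smooth_derive1 sf). Qed.

Lemma smooth_cont f : smooth f -> continuous f.
Proof. by move=> sf; exact: has_deriv_cont (smooth_deriv sf). Qed.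

(** Fatou's lemma, with integrability of the limit as part of the conclusion: this is how pointwise
    limits of test functions are recognized as elements of [L2]. *)
Lemma fatou_intR (u : nat -> R -> R) v (l : R) :
  (forall k, integrableR (u k)) -> (forall k x, 0 <= u k x) ->
  (forall x, (fun k => u k x) @ \oo --> v x) ->
  (fun k => intR (u k)) @ \oo --> l -> integrableR v /\ intR v <= l.
Proof.
move=> iu u0 uv ul.
have mu_ k : measurable_fun setT (EFin \o u k) by apply/measurable_EFinP; exact: integrableR_measurable.
have v0 x : 0 <= v x by apply: (ler_cvg_to (@cvg_cst _ 0 _ \oo _) (uv x)); apply: nearW => k; exact: u0.
have cE (w : nat -> R) (m : R) : w @ \oo --> m -> limn_einf (EFin \o w) = m%:E.
  move=> h; have hE : (EFin \o w) @ \oo --> m%:E by apply: cvg_EFin; [exact: nearW|exact: h].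
  by have [-> _] := cvg_limn_einf_sup hE.
have mv : measurable_fun setT v.
  apply: (@measurable_fun_cvg _ _ R setT u v) => //; first by move=> k; exact: integrableR_measurable.
have H := @fatou _ _ R mu setT measurableT (fun k x => (u k x)%:E) mu_ (fun k x _ => u0 k x).
have e1 : (\int[mu]_x limn_einf (fun k => (u k x)%:E) = \int[mu]_x (v x)%:E)%E.
  by apply: eq_integral => x _; exact: cE.
have e2 : limn_einf (fun k => (\int[mu]_x (u k x)%:E)%E) = l%:E.
  rewrite -(cE _ _ ul); congr limn_einf; apply/funext => k /=.
  by rewrite /intR /Rintegral fineK//; exact: (integrable_fin_num measurableT (iu k)).
rewrite e1 e2 in H.
have iv : integrableR v.
  apply/integrableP; split; first exact/measurable_EFinP.
  apply: le_lt_trans (ltry l); apply: le_trans H; rewrite le_eqVlt; apply/orP; left; apply/eqP.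
  by apply: eq_integral => x _ /=; rewrite ger0_norm.
split => //; rewrite -lee_fin /intR /Rintegral fineK//.
exact: (integrable_fin_num measurableT iv).
Qed.

End Integrals.

Arguments has_deriv_id {R} x.
Arguments has_deriv_cst {R} c x.
Arguments smooth_cst {R} c n x.
Arguments smooth_affine {R} f a b.

(** * Mean value estimates, Cauchy-Schwarz and a bump function *)

Section Calculus.
Variable R : realType.
Implicit Types (f g F G : R -> R) (a b c x y : R).

Lemma mvt F f a b : (forall x, a <= x <= b -> is_derive x (1 : R) F (f x)) -> a <= b ->
  exists c, a <= c <= b /\ F b - F a = f c * (b - a).
Proof.
move=> hF ab; have [||c hc e] := @MVT_segment R F f a b ab.
- by move=> x; rewrite in_itv/= => /andP[h1 h2]; apply: hF; rewrite !ltW.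
- by apply: derivable_within_continuous => y; rewrite in_itv/= => /hF[].
by exists c; move: hc; rewrite in_itv/=.
Qed.

Lemma deriv_ge0_le F f a b : (forall x, a <= x <= b -> is_derive x (1 : R) F (f x)) ->
  (forall x, a <= x <= b -> 0 <= f x) -> a <= b -> F a <= F b.
Proof.
move=> hF hf ab; have [c [hc e]] := mvt hF ab.
by rewrite -subr_ge0 e mulr_ge0 ?hf// subr_ge0.
Qed.

Lemma deriv_gt0_lt F f a b : (forall x, a <= x <= b -> is_derive x (1 : R) F (f x)) ->
  (forall x, a <= x <= b -> 0 < f x) -> a < b -> F a < F b.
Proof.
move=> hF hf ab; have [c [hc e]] := mvt hF (ltW ab).
by rewrite -subr_gt0 e mulr_gt0 ?hf// subr_gt0.
Qed.

Lemma deriv0_cst F a b : (forall x, a <= x <= b -> is_derive x (1 : R) F 0) ->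
  a <= b -> F a = F b.
Proof.
move=> hF ab; have [c [hc e]] := mvt hF ab.
by apply/esym/eqP; rewrite -subr_eq0 e mul0r.
Qed.

Lemma tangent_le F f f' : has_deriv F f -> has_deriv f f' ->
  (forall x, 0 <= f' x) -> forall a x, F a + f a * (x - a) <= F x.
Proof.
move=> hF hf h a x; have [ax|/ltW xa] := leP a x.
- have [c [/andP[ac cx] e]] := @mvt F f a x (fun y _ => hF y) ax.
  have [d [_ e']] := @mvt f f' a c (fun y _ => hf y) ac.
  rewrite addrC -lerBrDr e ler_wpM2r ?subr_ge0//.
  by rewrite -subr_ge0 e' mulr_ge0// subr_ge0.
- have [c [/andP[xc ca] e]] := @mvt F f x a (fun y _ => hF y) xa.
  have [d [_ e']] := @mvt f f' c a (fun y _ => hf y) ca.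
  have : 0 <= (f a - f c) * (a - x) by rewrite e' !mulr_ge0// subr_ge0.
  by lra.
Qed.

Lemma sqr_le_mul (A B C : R) : 0 <= A -> 0 <= C ->
  (forall t, 0 <= A + 2 * t * B + t ^+ 2 * C) -> B ^+ 2 <= A * C.
Proof.
move=> A0 C0 h; have [C1|Cn] := eqVneq C 0.
  suff -> : B = 0 by rewrite expr0n/= mulr_ge0.
  apply/eqP; apply: contraT => B0.
  (* For [C = 0] the expression is affine in [t], and this [t] gives it the value -1. *)
  have := h (- (A + 1) / (2 * B)); rewrite C1 mulr0 addr0.
  have -> : 2 * (- (A + 1) / (2 * B)) * B = - (A + 1) by field.
  by lra.
have Cp : 0 < C by rewrite lt_neqAle eq_sym Cn.
have := h (- B / C).
have -> : A + 2 * (- B / C) * B + (- B / C) ^+ 2 * C = (A * C - B ^+ 2) / C by field.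
by rewrite pmulr_lge0 ?invr_gt0// subr_ge0.
Qed.

(** The functions that repair orthogonality in [lam_ge] have to be continuous with compact support,
    so a truncated parabola serves as bump function. *)
Definition hat x : R := Num.max (1 - x ^+ 2) 0.

Lemma hat_ge0 x : 0 <= hat x.
Proof. by rewrite /hat le_max lexx orbT. Qed.

Lemma hat_gt0 x : x ^+ 2 < 1 -> 0 < hat x.
Proof. by move=> h; rewrite /hat lt_max subr_gt0 h. Qed.

Lemma hat0 : 0 < hat 0.
Proof. by apply: hat_gt0; rewrite expr0n/= ltr01. Qed.

Lemma cc_hat : cc hat.
Proof.
split.
  move=> x; apply: (@continuous_max _ _ (fun x : R => 1 - x ^+ 2) (fun=> 0)); last exact: cvg_cst.
  by apply: continuousB; [exact: cvg_cst|exact: exprn_continuous].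
by exists (-1), 1 => x hx; apply/max_idPr; rewrite subr_le0; case: hx => ?; nra.
Qed.

Lemma segment_bounded f a b : continuous f -> exists M, 0 <= M /\ forall x, a <= x <= b -> `|f x| <= M.
Proof.
move=> cf; have [ab|ba] := leP a b; last first.
  by exists 0; split => // x /andP[ax xb]; have := le_trans ax xb; rewrite leNgt ba.
have [|c _ hc] := @EVT_max R (fun x => `|f x|) a b ab.
  by apply: continuous_subspaceT => x; apply: continuous_comp; [exact: cf|exact: norm_continuous].
by exists `|f c|; split => // x hx; apply: hc; rewrite in_itv.
Qed.

Lemma cc_bounded f : cc f -> exists M, 0 <= M /\ forall x, `|f x| <= M.
Proof.
move=> [cf [a [b h]]]; have [M [M0 hM]] := segment_bounded a b cf.
exists M; split => // x; have [xa|ax] := ltP x a; first by rewrite h ?normr0//; left.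
have [bx|xb] := ltP b x; first by rewrite h ?normr0//; right.
by apply: hM; rewrite ax.
Qed.

Lemma intR_CS f g : integrableR (fun x => f x ^+ 2) -> integrableR (fun x => g x ^+ 2) ->
  integrableR (fun x => f x * g x) ->
  intR (fun x => f x * g x) ^+ 2 <= intR (fun x => f x ^+ 2) * intR (fun x => g x ^+ 2).
Proof.
move=> hf hg hfg; apply: sqr_le_mul.
- by apply: intR_ge0 => x; exact: sqr_ge0.
- by apply: intR_ge0 => x; exact: sqr_ge0.
move=> t.
rewrite -!intRZ// -intRD//; last exact: integrableRZ.
rewrite -intRD//; [|apply: integrableRD => //; exact: integrableRZ|exact: integrableRZ].
apply: intR_ge0 => x.
have -> : f x ^+ 2 + 2 * t * (f x * g x) + t ^+ 2 * g x ^+ 2 = (f x + t * g x) ^+ 2 by ring.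
exact: sqr_ge0.
Qed.

Lemma cvg0Mr (u : nat -> R) c : u @ \oo --> (0 : R) -> (fun k => u k * c) @ \oo --> (0 : R).
Proof. by move=> h; rewrite -(mul0r c); apply: cvgM => //; exact: cvg_cst. Qed.

End Calculus.

(** * The weighted space L2(mu) and lower bounds for [lam] *)

Section L2theory.
Variable R : realType.
Variable V : R -> R.
Hypothesis cV : continuous V.
Hypothesis iwt : integrableR (wt V).
Implicit Types (f g h : R -> R).

Lemma wt_gt0 x : 0 < wt V x.
Proof. exact: expR_gt0. Qed.

Lemma wt_ge0 x : 0 <= wt V x.
Proof. exact/ltW/wt_gt0. Qed.

Lemma continuous_wt : continuous (wt V).
Proof.
move=> x; apply: continuous_comp; last exact: continuous_expR.
by apply: continuousN; exact: cV.
Qed.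

Lemma measurable_wt : measurable_fun setT (wt V).
Proof. by apply: measurable_cont; exact: continuous_wt. Qed.

Lemma L2P f : L2 V f <-> measurable_fun setT f /\ integrableR (fun x => f x ^+ 2 * wt V x).
Proof.
split=> [[mf h]|[mf /integrableP[_ h]]]; split=> //.
  apply/integrableP; split.
    apply/measurable_EFinP; apply: measurable_funM; last exact: measurable_wt.
    exact: measurable_funX.
  rewrite (_ : (\int[_]_x _)%E = \int[@lebesgue_measure R]_x (f x ^+ 2 * wt V x)%:E)%E//.
  by apply: eq_integral => x _; rewrite /= ger0_norm// mulr_ge0 ?sqr_ge0 ?wt_ge0.
rewrite (_ : (\int[_]_x _)%E = \int[@lebesgue_measure R]_x `|((fun x => f x ^+ 2 * wt V x) x)%:E|)%E//.
by apply: eq_integral => x _; rewrite /= ger0_norm// mulr_ge0 ?sqr_ge0 ?wt_ge0.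
Qed.

Lemma L2_measurable f : L2 V f -> measurable_fun setT f.
Proof. by case. Qed.

Lemma L2_int f : L2 V f -> integrableR (fun x => f x ^+ 2 * wt V x).
Proof. by move=> /L2P[]. Qed.

Lemma L2_mul f g : L2 V f -> L2 V g -> integrableR (fun x => f x * g x * wt V x).
Proof.
move=> hf hg.
apply: (@le_integrableR _ _ (fun x => f x ^+ 2 * wt V x + g x ^+ 2 * wt V x)).
- apply: measurable_funM; last exact: measurable_wt.
  by apply: measurable_funM; exact: L2_measurable.
- move=> x; rewrite normrM (ger0_norm (wt_ge0 x)) -mulrDl ler_wpM2r ?wt_ge0//.
  rewrite normrM -(real_normK (num_real (f x))) -(real_normK (num_real (g x))).
  have := sqr_ge0 (`|f x| - `|g x|); have := normr_ge0 (f x); have := normr_ge0 (g x); nra.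
- by apply: integrableRD; exact: L2_int.
Qed.

Lemma L2D f g : L2 V f -> L2 V g -> L2 V (fun x => f x + g x).
Proof.
move=> hf hg; apply/L2P; split.
  by apply: measurable_funD; exact: L2_measurable.
apply: (@integrableR_ext _ (fun x => f x ^+ 2 * wt V x + (2 * (f x * g x * wt V x) + g x ^+ 2 * wt V x))).
  by move=> x; ring.
apply: integrableRD; first exact: L2_int.
by apply: integrableRD; [apply: integrableRZ; exact: L2_mul|exact: L2_int].
Qed.

Lemma L2Z c f : L2 V f -> L2 V (fun x => c * f x).
Proof.
move=> hf; apply/L2P; split.
  by apply: measurable_funM => //; exact: L2_measurable.
apply: (@integrableR_ext _ (fun x => c ^+ 2 * (f x ^+ 2 * wt V x))).
  by move=> x; ring.
by apply: integrableRZ; exact: L2_int.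
Qed.

Lemma L2B f g : L2 V f -> L2 V g -> L2 V (fun x => f x - g x).
Proof.
move=> hf hg; rewrite (_ : (fun x => _) = fun x => f x + (-1) * g x).
  by apply: L2D => //; exact: L2Z.
by apply/funext => x; rewrite mulN1r.
Qed.

Lemma L2_bounded f (c : R) : measurable_fun setT f -> (forall x, `|f x| <= c) -> L2 V f.
Proof.
move=> mf h; apply/L2P; split => //.
apply: (@le_integrableR _ _ (fun x => c ^+ 2 * wt V x)).
- by apply: measurable_funM; [exact: measurable_funX|exact: measurable_wt].
- move=> x; rewrite normrM (ger0_norm (wt_ge0 x)) ler_wpM2r ?wt_ge0// normrX.
  by rewrite lerXn2r// ?nnegrE// (le_trans _ (h x)).
- exact: integrableRZ.
Qed.

Lemma L2_cst c : L2 V (fun=> c).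
Proof. by apply: (@L2_bounded _ `|c|) => //. Qed.

Lemma L2_cc f : cc f -> L2 V f.
Proof.
move=> hf; apply/L2P; split; first by apply: measurable_cont; exact: cc_cont.
apply: integrable_cc.
apply: (@cc_ext _ (fun x => (f x * wt V x) * f x)); first by move=> x; ring.
by apply: ccM => // x; apply: continuousM; [exact: (cc_cont hf)|exact: continuous_wt].
Qed.

Lemma Zc_ge0 : 0 <= Zc V.
Proof. exact/intR_ge0/wt_ge0. Qed.

Lemma ipE f g : ip V f g = intR (fun x => f x * g x * wt V x) / Zc V.
Proof. by []. Qed.

Lemma ipC f g : ip V f g = ip V g f.
Proof. by rewrite !ipE; congr (_ / _); apply: intR_ext => x; ring. Qed.

Lemma ipDl f g h : L2 V f -> L2 V g -> L2 V h ->
  ip V (fun x => f x + g x) h = ip V f h + ip V g h.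
Proof.
move=> hf hg hh; rewrite !ipE -mulrDl -intRD; [|exact: L2_mul..].
by congr (_ / _); apply: intR_ext => x; ring.
Qed.

Lemma ipZl c f h : L2 V f -> L2 V h -> ip V (fun x => c * f x) h = c * ip V f h.
Proof.
move=> hf hh; rewrite !ipE mulrA -intRZ; last exact: L2_mul.
by congr (_ / _); apply: intR_ext => x; ring.
Qed.

Lemma ipBl f g h : L2 V f -> L2 V g -> L2 V h ->
  ip V (fun x => f x - g x) h = ip V f h - ip V g h.
Proof.
move=> hf hg hh; rewrite !ipE -mulrBl -intRB; [|exact: L2_mul..].
by congr (_ / _); apply: intR_ext => x; ring.
Qed.

Lemma ipDr f g h : L2 V f -> L2 V g -> L2 V h ->
  ip V h (fun x => f x + g x) = ip V h f + ip V h g.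
Proof. by move=> *; rewrite ipC ipDl// (ipC f) (ipC g). Qed.

Lemma ipZr c f h : L2 V f -> L2 V h -> ip V h (fun x => c * f x) = c * ip V h f.
Proof. by move=> *; rewrite ipC ipZl// (ipC f). Qed.

Lemma ipBr f g h : L2 V f -> L2 V g -> L2 V h ->
  ip V h (fun x => f x - g x) = ip V h f - ip V h g.
Proof. by move=> *; rewrite ipC ipBl// (ipC f) (ipC g). Qed.

Lemma nrm2_ge0 f : 0 <= nrm2 V f.
Proof.
rewrite /nrm2 ipE divr_ge0 ?Zc_ge0//; apply: intR_ge0 => x.
by rewrite -expr2 mulr_ge0 ?sqr_ge0 ?wt_ge0.
Qed.

Lemma ip0l g : ip V (fun=> 0) g = 0.
Proof.
rewrite ipE (@intR_ext _ _ (fun=> 0)); last by move=> x; rewrite !mul0r.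
by rewrite /intR Rintegral_cst//= mul0r mul0r.
Qed.

Lemma nrm2_subrr f : nrm2 V (fun x => f x - f x) = 0.
Proof.
by rewrite (_ : (fun x => _) = fun=> 0) ?/nrm2 ?ip0l//; apply/funext => x; rewrite subrr.
Qed.

(** Parallelogram law: the right side minus the left is [nrm2] of [f + g]. *)
Lemma nrm2B_le f g : L2 V f -> L2 V g ->
  nrm2 V (fun x => f x - g x) <= 2 * nrm2 V f + 2 * nrm2 V g.
Proof.
move=> hf hg; have hD := L2D hf hg; have hB := L2B hf hg.
have := nrm2_ge0 (fun x => f x + g x).
by rewrite /nrm2 (ipBl hf hg hB) !ipBr// (ipDl hf hg hD) !ipDr// (ipC g f); lra.
Qed.

Lemma ip_CS f g : L2 V f -> L2 V g -> ip V f g ^+ 2 <= nrm2 V f * nrm2 V g.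
Proof.
move=> hf hg; apply: sqr_le_mul; [exact: nrm2_ge0..|] => t.
have htg : L2 V (fun x => t * g x) by exact: L2Z.
have hD : L2 V (fun x => f x + t * g x) by exact: L2D.
have := nrm2_ge0 (fun x => f x + t * g x).
rewrite /nrm2 ipDl// !ipDr// !ipZl// !ipZr// (ipC g f) => h.
by apply: le_trans h _; rewrite le_eqVlt; apply/orP; left; apply/eqP; ring.
Qed.

Lemma ip_le f g : L2 V f -> L2 V g -> `|ip V f g| <= Num.sqrt (nrm2 V f) * Num.sqrt (nrm2 V g).
Proof.
move=> hf hg; rewrite -sqrtrM ?nrm2_ge0// -sqrtr_sqr ler_sqrt ?ip_CS//.
by rewrite mulr_ge0 ?nrm2_ge0.
Qed.

Lemma ip_eq0 f g : L2 V f -> L2 V g -> nrm2 V f = 0 -> ip V f g = 0.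
Proof.
by move=> hf hg h; apply/eqP; rewrite -normr_le0 (le_trans (ip_le hf hg))// h sqrtr0 mul0r.
Qed.

(** Expanding around the limits leaves three pairings in which one factor tends to 0 in norm;
    Cauchy-Schwarz disposes of each. *)
Lemma cvg_ip (u v : nat -> R -> R) f g :
  (forall k, L2 V (u k)) -> (forall k, L2 V (v k)) -> L2 V f -> L2 V g ->
  (fun k => nrm2 V (fun x => u k x - f x)) @ \oo --> (0 : R) ->
  (fun k => nrm2 V (fun x => v k x - g x)) @ \oo --> (0 : R) ->
  (fun k => ip V (u k) (v k)) @ \oo --> ip V f g.
Proof.
move=> hu hv hf hg cu cv.
have sq (w : nat -> R) : w @ \oo --> (0 : R) -> (fun k => Num.sqrt (w k)) @ \oo --> (0 : R).
  move=> hw; rewrite -[X in _ --> X](@sqrtr0 R).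
  by apply: (continuous_cvg _ _ hw); exact: sqrt_continuous.
have zz w : (forall k : nat, L2 V (w k)) -> (fun k => nrm2 V (w k)) @ \oo --> (0 : R) ->
   forall w' l, (forall k, L2 V (w' k)) -> (fun k => nrm2 V (w' k)) @ \oo --> (l : R) ->
   (fun k => ip V (w k) (w' k)) @ \oo --> (0 : R).
  move=> hw cw w' l hw' cw'; apply/norm_cvg0P.
  apply: (@squeeze_cvgr _ _ _ _ (fun=> 0) (fun k => Num.sqrt (nrm2 V (w k)) * Num.sqrt (nrm2 V (w' k)))).
  - by apply: nearW => k; rewrite normr_ge0/= ip_le.
  - exact: cvg_cst.
  - rewrite -(mul0r (Num.sqrt l)); apply: cvgM; first exact: sq.
    by apply: (continuous_cvg _ _ cw'); exact: sqrt_continuous.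
have e k : ip V (u k) (v k) = ip V (fun x => u k x - f x) (fun x => v k x - g x)
   + ip V (fun x => u k x - f x) g + ip V (fun x => v k x - g x) f + ip V f g.
  rewrite (ipBl (hu k) hf); last exact: L2B.
  rewrite !ipBr// (ipBl (hu k))// (ipBl (hv k))// (ipC (v k) f) (ipC g f); ring.
have E : (fun k => ip V (u k) (v k)) = (fun k => ip V (fun x => u k x - f x) (fun x => v k x - g x)
   + ip V (fun x => u k x - f x) g + ip V (fun x => v k x - g x) f + ip V f g).
  by apply/funext => k; rewrite e.
rewrite E.
suff : (fun k => ip V (fun x => u k x - f x) (fun x => v k x - g x)
   + ip V (fun x => u k x - f x) g + ip V (fun x => v k x - g x) f + ip V f g) @ \oo --> 0 + 0 + 0 + ip V f g.
  by rewrite !add0r.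
apply: cvgD; last exact: cvg_cst.
apply: cvgD.
  apply: cvgD.
    apply: (zz _ _ cu _ 0 _ cv); first by move=> k; exact: L2B.
    by move=> k; exact: L2B.
  apply: (zz _ _ cu (fun=> g) (nrm2 V g)) => //; first by move=> k; exact: L2B.
  exact: cvg_cst.
apply: (zz _ _ cv (fun=> f) (nrm2 V f)) => //; first by move=> k; exact: L2B.
exact: cvg_cst.
Qed.

End L2theory.

(** * Rayleigh quotients and approximation by test functions *)

Section Rayleigh.
Variable R : realType.
Variable V : R -> R.
Hypothesis sV : smooth V.
Hypothesis iwt : integrableR (wt V).
Implicit Types (f g h : R -> R).

Let cV : continuous V. Proof. exact: smooth_cont. Qed.
Let cwt : continuous (wt V). Proof. exact: continuous_wt. Qed.

Lemma wt_deriv : has_deriv (wt V) (fun x => - derive1 V x * wt V x).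
Proof.
move=> x; have hV := smooth_deriv sV x.
have hN : is_derive x (1 : R) (fun y => - V y) (- derive1 V x) by exact: is_deriveN.
have := @is_derive1_comp R expR (fun y => - V y) x _ _ (is_derive_expR (- V x)) hN.
by rewrite mulrC.
Qed.

Lemma Cc_inf_cc f : Cc_inf f -> cc f.
Proof. by case=> sf cf; split => //; exact: smooth_cont. Qed.

Lemma Cc_inf_deriv f : Cc_inf f -> Cc_inf (derive1 f).
Proof.
by case=> sf cf; split; [exact: smooth_derive1|exact: compact_supp_deriv (smooth_deriv sf) cf].
Qed.

Lemma cc_Lop f : Cc_inf f -> cc (Lop V f).
Proof.
move=> hf; have hf1 := Cc_inf_deriv hf; have hf2 := Cc_inf_deriv hf1.
apply: ccB; first exact: Cc_inf_cc hf2.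
apply: ccM; last exact: Cc_inf_cc hf1.
by apply: smooth_cont; exact: smooth_derive1.
Qed.

Lemma L2_Lop f : Cc_inf f -> L2 V (Lop V f).
Proof. by move=> hf; apply: L2_cc => //; exact: cc_Lop. Qed.

Lemma L2_Cc_inf f : Cc_inf f -> L2 V f.
Proof. by move=> hf; apply: L2_cc => //; exact: Cc_inf_cc. Qed.

Lemma closL_Cc_inf f : Cc_inf f -> closL V f (Lop V f).
Proof.
move=> hf; split; first exact: L2_Cc_inf; split; first exact: L2_Lop.
exists (fun=> f); split => //.
by split; under eq_fun do rewrite nrm2_subrr; exact: cvg_cst.
Qed.

Lemma ip_Lop f : Cc_inf f -> ip V f (Lop V f) = - nrm2 V (derive1 f).
Proof.
move=> hf; have hf1 := Cc_inf_deriv hf; have hf2 := Cc_inf_deriv hf1.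
have sf := hf.1; have d0 := smooth_deriv sf; have d1 := smooth_deriv2 sf.
have dw := wt_deriv.
apply/eqP; rewrite -subr_eq0 opprK /nrm2 !ipE -mulrDl -intRD; last 2 first.
- by apply: L2_mul => //; [exact: L2_Cc_inf|exact: L2_Lop].
- by apply: L2_mul => //; exact: L2_Cc_inf.
pose G x := f x * derive1 f x * wt V x.
have hG : has_deriv G (fun x => f x * Lop V f x * wt V x + derive1 f x * derive1 f x * wt V x).
  move=> x; have := d0 x; have := d1 x; have := dw x => H1 H2 H3.
  rewrite /G; apply: is_derive_eq.
  rewrite /Lop /GRing.scale/=; ring.
rewrite (intR_deriv0 hG) ?mul0r//.
  apply: ccD; apply: ccMr => //.
  - by apply: ccM; [exact: smooth_cont|exact: cc_Lop].
  - by apply: ccM; [exact: smooth_cont hf1.1|exact: Cc_inf_cc].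
have [a [b h]] := hf.2; exists a, b => x hx.
by rewrite /G h// !mul0r.
Qed.

Definition cvL2 (u : nat -> R -> R) f :=
  (fun k => nrm2 V (fun x => u k x - f x)) @ \oo --> (0 : R).

Lemma cvL2_cst f : cvL2 (fun=> f) f.
Proof. by rewrite /cvL2; under eq_fun do rewrite nrm2_subrr; exact: cvg_cst. Qed.

Lemma cvL2B (u v : nat -> R -> R) f g :
  (forall k, L2 V (u k)) -> (forall k, L2 V (v k)) -> L2 V f -> L2 V g ->
  cvL2 u f -> cvL2 v g -> cvL2 (fun k x => u k x - v k x) (fun x => f x - g x).
Proof.
move=> hu hv hf hg cu cv; rewrite /cvL2.
apply: (@squeeze_cvgr _ _ _ _ (fun=> 0) (fun k => 2 * nrm2 V (fun x => u k x - f x) + 2 * nrm2 V (fun x => v k x - g x))).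
- apply: nearW => k; rewrite nrm2_ge0/=.
  have h1 : L2 V (fun x => u k x - f x) by exact: L2B.
  have h2 : L2 V (fun x => v k x - g x) by exact: L2B.
  have -> : (fun x => u k x - v k x - (f x - g x)) = (fun x => (u k x - f x) - (v k x - g x)).
    by apply/funext => x; ring.
  exact: nrm2B_le.
- exact: cvg_cst.
- rewrite -[X in _ --> X](addr0 (0 : R)); apply: cvgD.
    by rewrite -(mulr0 (2 : R)); apply: cvgM; [exact: cvg_cst|exact: cu].
  by rewrite -(mulr0 (2 : R)); apply: cvgM; [exact: cvg_cst|exact: cv].
Qed.

Lemma cvL2Z (a : nat -> R) f : L2 V f -> a @ \oo --> (0 : R) -> cvL2 (fun k x => a k * f x) (fun=> 0).
Proof.
move=> hf ca; rewrite /cvL2.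
have -> : (fun k => nrm2 V (fun x => a k * f x - 0)) = (fun k => a k * a k * nrm2 V f).
  apply/funext => k; rewrite /nrm2 !ipE mulrA -intRZ; last exact: L2_mul.
  by congr (_ / _); apply: intR_ext => x; ring.
rewrite -(mul0r (nrm2 V f)) -(mul0r (0 : R)); apply: cvgM; last exact: cvg_cst.
exact: cvgM.
Qed.

Lemma cvL2_sum n (a : nat -> nat -> R) (b : nat -> R -> R) :
  (forall i, (i < n)%N -> L2 V (b i)) ->
  (forall i, (i < n)%N -> (fun k => a k i) @ \oo --> (0 : R)) ->
  (forall k, L2 V (fun x => \sum_(i < n) a k i * b i x)) /\
  cvL2 (fun k x => \sum_(i < n) a k i * b i x) (fun=> 0).
Proof.
elim: n => [|n IH] hb ha.
  have e k : (fun x => \sum_(i < 0) a k i * b i x) = fun=> 0.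
    by apply/funext => x; rewrite big_ord0.
  split; first by move=> k; rewrite e; exact: L2_cst.
  rewrite /cvL2; have -> : (fun k => nrm2 V (fun x => \sum_(i < 0) a k i * b i x - 0)) = fun=> 0.
    apply/funext => k; rewrite -[RHS](nrm2_subrr V (fun=> 0)); congr (nrm2 V _).
    by apply/funext => x; rewrite big_ord0.
  exact: cvg_cst.
have [||h1 h2] := IH; [by move=> i hi; apply: hb; exact: ltnW|by move=> i hi; apply: ha; exact: ltnW|].
have e k : (fun x => \sum_(i < n.+1) a k i * b i x) = fun x => \sum_(i < n) a k i * b i x - (- a k n) * b n x.
  by apply/funext => x; rewrite big_ord_recr/= mulNr opprK.
have hbn k : L2 V (fun x => (- a k n) * b n x) by apply: L2Z => //; exact: hb.
split; first by move=> k; rewrite e; exact: L2B.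
have -> : (fun k x => \sum_(i < n.+1) a k i * b i x) = fun k x => \sum_(i < n) a k i * b i x - (- a k n) * b n x.
  by apply/funext => k; exact: e.
have -> : (fun=> 0) = (fun x : R => 0 - 0) :> (R -> R) by apply/funext => x; rewrite subr0.
apply: cvL2B => //; [exact: L2_cst|exact: L2_cst|].
apply: cvL2Z; first exact: hb.
by rewrite -oppr0; apply: cvgN; exact: ha.
Qed.

(* The constraint functions [b] repair the orthogonality lost when an element of the domain is
   approximated by test functions, so that only compactly supported [f] have to be considered. *)
Lemma lam_ge n (c : R) (g b : nat -> R -> R) :
  (forall i, (i < n)%N -> L2 V (g i)) ->
  (forall i, (i < n)%N -> cc (b i)) ->
  (forall i j, (i < n)%N -> (j < n)%N -> ip V (b i) (g j) = (i == j)%:R) ->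
  (forall f, cc f -> (forall i, (i < n)%N -> ip V f (g i) = 0) ->
     forall phi, Cc_inf phi -> c * ip V phi f ^+ 2 <= nrm2 V f * nrm2 V (derive1 phi)) ->
  (c%:E <= lam V n)%E.
Proof.
move=> hg hb bg H.
apply: (@le_trans _ _ (ereal_inf [set w : \bar R | exists f h, closL V f h /\ nrm2 V f != 0 /\
          (forall i, (i < n)%N -> ip V f (g i) = 0) /\
          w = ((- ip V f h) / nrm2 V f)%:E])); last first.
  by apply: ereal_sup_ubound; exists g.
apply: le_ereal_inf_tmp => _ [f [h [[Lf [Lh [phi [hphi [c1 c2]]]]] [f0 [fg ->]]]]].
rewrite lee_fin ler_pdivlMr; last by rewrite lt_neqAle eq_sym f0 nrm2_ge0.
have Lphi k : L2 V (phi k) by exact: L2_Cc_inf.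
pose a k i := ip V (phi k) (g i).
have Lb i : (i < n)%N -> L2 V (b i) by move=> /hb; exact: L2_cc.
have ca i : (i < n)%N -> (fun k => a k i) @ \oo --> (0 : R).
  move=> hi; rewrite -(fg _ hi); apply: cvg_ip => //; first by move=> k; exact: hg.
    exact: hg.
  exact: cvL2_cst.
have [Ls cs] := cvL2_sum Lb ca.
pose F k x := phi k x - \sum_(i < n) a k i * b i x.
have ccF k : cc (F k).
  apply: ccB; first exact: Cc_inf_cc.
  by apply: cc_sum => i; apply: ccZ; exact: hb.
have LF k : L2 V (F k) by exact: L2_cc.
have cF : cvL2 F f.
  have -> : f = fun x => f x - 0 by apply/funext => x; rewrite subr0.
  by apply: cvL2B => //; exact: L2_cst.
have orth k j : (j < n)%N -> ip V (F k) (g j) = 0.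
  move=> hj; rewrite ipBl//; last exact: hg.
  suff -> : ip V (fun x => \sum_(i < n) a k i * b i x) (g j) = a k j by rewrite subrr.
  have aux m : (m <= n)%N -> L2 V (fun x => \sum_(i < m) a k i * b i x) /\
      ip V (fun x => \sum_(i < m) a k i * b i x) (g j) = \sum_(i < m) a k i * (val i == j)%:R.
    elim: m => [_|m IH mn].
      have -> : (fun x => \sum_(i < 0) a k i * b i x) = fun=> 0.
        by apply/funext => x; rewrite big_ord0.
      split; first exact: L2_cst.
      by rewrite big_ord0 ip0l.
    have [h1 h2] := IH (ltnW mn).
    have -> : (fun x => \sum_(i < m.+1) a k i * b i x) = fun x => \sum_(i < m) a k i * b i x + a k m * b m x.
      by apply/funext => x; rewrite big_ord_recr.
    have h3 : L2 V (fun x => a k m * b m x) by apply: L2Z => //; exact: Lb.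
    split; first exact: L2D.
    rewrite ipDl//; last exact: hg.
    by rewrite h2 ipZl ?bg// ?big_ord_recr//; [exact: Lb|exact: hg].
  have [_ ->] := aux n (leqnn n).
  rewrite (bigD1 (Ordinal hj))//= eqxx mulr1 big1 ?addr0// => i /negP ij.
  by case: eqP => [e|]; rewrite ?mulr0//; case: ij; apply/eqP/val_inj.
(* [phi k] has the smoothness required by [ip_Lop], [F k] the orthogonality required by [H]. Both
   tend to [f], and in the limit the mixed inequality becomes the Rayleigh bound times
   [nrm2 V f]. *)
have le k : c * ip V (phi k) (F k) ^+ 2 <= nrm2 V (F k) * - ip V (phi k) (Lop V (phi k)).
  by rewrite ip_Lop// opprK; apply: H => //; exact: orth.
have L1 : (fun k => c * ip V (phi k) (F k) ^+ 2) @ \oo --> c * nrm2 V f ^+ 2.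
  apply: cvgM; first exact: cvg_cst.
  by rewrite !expr2; apply: cvgM; exact: cvg_ip.
have L2' : (fun k => nrm2 V (F k) * - ip V (phi k) (Lop V (phi k))) @ \oo --> nrm2 V f * - ip V f h.
  apply: cvgM; first exact: cvg_ip.
  by apply: cvgN; apply: cvg_ip => // k; exact: L2_Lop.
have nf : 0 < nrm2 V f by rewrite lt_neqAle eq_sym f0 nrm2_ge0.
have : c * nrm2 V f ^+ 2 <= nrm2 V f * - ip V f h.
  by apply: (ler_cvg_to L1 L2'); exact: nearW.
by rewrite expr2 mulrA (mulrC (nrm2 V f) (- _)) ler_pM2r.
Qed.

End Rayleigh.

(** * Passage to the supersymmetric partner *)

Section LowerBound.
Variable R : realType.
Variable V : R -> R.
Hypothesis sV : smooth V.
Hypothesis iwt : integrableR (wt V).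
Implicit Types (f g h : R -> R).

Let cV : continuous V. Proof. exact: smooth_cont. Qed.
Let cwt : continuous (wt V). Proof. exact: continuous_wt. Qed.

Lemma intR_gt0 f a : continuous f -> integrableR f -> (forall x, 0 <= f x) -> 0 < f a -> 0 < intR f.
Proof.
move=> cf itf f0 fa.
have [e e0 he] : exists2 e : R, 0 < e & forall y, `|y - a| <= e -> f a / 2 < f y.
  have : \forall y \near a, f a / 2 < f y.
    by apply: (cvgr_gt _ (cf a)); lra.
  move=> /nbhs_ballP[e /= e0 he]; exists (e / 2); first by rewrite divr_gt0.
  move=> y hy; apply: he; rewrite /ball/= distrC; apply: le_lt_trans hy _; lra.
have [G hG] := primitive_exists cf.
have le : a - e <= a + e by lra.
have h1 := ftc_itv le hG cf.
have h2 : intR (f \_ `[a - e, a + e]) <= intR f.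
  apply: le_intR => //; first exact: integrable_itv.
  by move=> x; rewrite patchE; case: ifP.
apply: lt_le_trans h2; rewrite h1 subr_gt0.
apply: (deriv_gt0_lt (fun x _ => hG x)); last by lra.
move=> x hx; apply: lt_trans (he x _); first by rewrite divr_gt0.
by rewrite ler_norml; move/andP: hx => [? ?]; apply/andP; split; lra.
Qed.

Lemma Zc_gt0 : 0 < Zc V.
Proof. by apply: (intR_gt0 (a := 0)) => //; [move=> x; exact: wt_ge0|exact: wt_gt0]. Qed.

Let Zc0 : Zc V != 0. Proof. by rewrite gt_eqF// Zc_gt0. Qed.

Lemma nrm2_intR f : intR (fun x => f x ^+ 2 * wt V x) = nrm2 V f * Zc V.
Proof. by rewrite /nrm2 ipE divfK//; congr intR; apply/funext => x; rewrite expr2. Qed.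

Lemma L2_indic (i : interval R) : L2 V (\1_[set` i]).
Proof.
apply: (@L2_bounded _ _ cV iwt _ 1); first exact: measurable_indic.
by move=> x; rewrite indicE; case: (_ \in _); rewrite ?normr1 ?normr0.
Qed.

Lemma nrm2_indic (i : interval R) : nrm2 V (\1_[set` i]) <= 1.
Proof.
rewrite /nrm2 ipE ler_pdivrMr ?Zc_gt0// mul1r; apply: le_intR => //.
  by apply: L2_mul => //; exact: L2_indic.
by move=> x; rewrite indicE; case: (_ \in _); rewrite ?mul0r ?mul1r// wt_ge0.
Qed.

(** As inner products, integrals over intervals can be bounded by Cauchy-Schwarz and pass to [L2]
    limits. *)
Lemma ip_indic (i : interval R) f :
  intR ((fun x => f x * wt V x) \_ [set` i]) = Zc V * ip V f (\1_[set` i]).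
Proof.
rewrite ipE mulrC divfK//; apply: intR_ext => x; rewrite patchE indicE.
by case: (_ \in _); rewrite ?mulr1// mulr0 mul0r.
Qed.

Lemma ip_indic_le (i : interval R) f : L2 V f -> ip V f (\1_[set` i]) ^+ 2 <= nrm2 V f.
Proof.
move=> hf; apply: le_trans (ip_CS cV hf (L2_indic i)) _.
by rewrite -[leRHS]mulr1 ler_wpM2l ?nrm2_ge0// nrm2_indic.
Qed.

(** A vanishing integral brings the primitive back to its initial value, so one normalization makes
    it vanish on both sides. Orthogonality to 1, and one factorization later to the eigenfunction,
    is exploited through this. *)
Lemma cc_primitive f : cc f -> intR f = 0 -> exists z, has_deriv z f /\ cc z.
Proof.
move=> hf i0; have [a [b [ab [h _]]]] := cc_restrict hf.
have [z hz] := primitive_exists (cc_cont hf).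
have [A0 B0] : a - 1 < a /\ b < b + 1 by split; lra.
have hz' : has_deriv (fun x => z x - z (a - 1)) f.
  by move=> x; have H := hz x; apply: is_derive_eq; rewrite subr0.
exists (fun x => z x - z (a - 1)); split => //; split; first exact: has_deriv_cont hz'.
have zab : z (b + 1) = z (a - 1).
  apply/eqP; rewrite -subr_eq0 -(@ftc_cc _ z f) ?i0//; first by lra.
    exact: cc_cont.
  by move=> x [hx|hx]; apply: h; [left|right]; lra.
have z0 x y : x <= y -> y < a \/ b < x -> z x = z y.
  move=> xy hxy; apply: deriv0_cst xy => t /andP[t1 t2].
  by have := hz t; rewrite h//; case: hxy => ?; [left|right]; lra.
exists (a - 1), (b + 1) => x [xa|bx].
  by rewrite (z0 x (a - 1)) ?subrr//; [exact: ltW|left].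
by rewrite -(z0 (b + 1) x) ?zab ?subrr//; [exact: ltW|right].
Qed.

(* Integration by parts turns [ip phi f] into a pairing of [phi'] with [z]; Cauchy-Schwarz then trades
   a spectral inequality for [L] for one about the supersymmetric partner acting on [z]. *)
Lemma duality_ineq f z (c : R) : cc f -> has_deriv z (fun x => f x * wt V x) -> cc z -> 0 <= c ->
  c * intR (fun x => z x ^+ 2 / wt V x) <= intR (fun x => f x ^+ 2 * wt V x) ->
  forall phi, Cc_inf phi -> c * ip V phi f ^+ 2 <= nrm2 V f * nrm2 V (derive1 phi).
Proof.
move=> hf hz cz c0 H phi hphi; have hphi1 := Cc_inf_deriv hphi.
have d0 := smooth_deriv hphi.1.
have cphi := cc_cont (Cc_inf_cc hphi).
have cphi1 := cc_cont (Cc_inf_cc hphi1).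
(* [w] is the inverse square root of [wt]. It distributes the weight so that Cauchy-Schwarz pairs
   [p], the derivative of [phi] over [w], with [q = z * w]. *)
pose w x := expR (V x / 2).
have w2 x : w x ^+ 2 = (wt V x)^-1.
  by rewrite /w /wt expr2 -expRD -expRN; congr expR; lra.
have ww x : w x * w x * wt V x = 1.
  by rewrite -expr2 w2 mulVf// gt_eqF// wt_gt0.
have cw : continuous w.
  move=> x; apply: continuous_comp; last exact: continuous_expR.
  by apply: continuousM; [exact: cV|exact: cvg_cst].
have E : intR (fun x => phi x * f x * wt V x) = - intR (fun x => derive1 phi x * z x).
  apply/eqP; rewrite -subr_eq0 opprK -intRD; last 2 first.
  - by apply: L2_mul => //; [exact: L2_Cc_inf|exact: L2_cc].
  - by apply: integrable_cc; exact: ccM.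
  apply/eqP; apply: (@intR_deriv0 _ (fun x => phi x * z x)).
  - move=> x; have H1 := d0 x; have H2 := hz x; apply: is_derive_eq.
    by rewrite /GRing.scale/=; ring.
  - apply: ccD; last exact: ccM.
    by apply: ccMr => //; exact: ccM.
  - have [a [b h]] := hphi.2; exists a, b => x hx.
    by rewrite h// mul0r.
have cs : intR (fun x => derive1 phi x * z x) ^+ 2 <=
    intR (fun x => derive1 phi x ^+ 2 * wt V x) * intR (fun x => z x ^+ 2 / wt V x).
  pose p x := derive1 phi x * (w x * wt V x).
  pose q x := z x * w x.
  have -> : (fun x => derive1 phi x * z x) = fun x => p x * q x.
    apply/funext => x; rewrite /p /q.
    by transitivity (derive1 phi x * z x * (w x * w x * wt V x)); [rewrite ww mulr1|ring].
  have -> : (fun x => derive1 phi x ^+ 2 * wt V x) = fun x => p x ^+ 2.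
    apply/funext => x; rewrite /p.
    by transitivity (derive1 phi x ^+ 2 * wt V x * (w x * w x * wt V x)); [rewrite ww mulr1|ring].
  have -> : (fun x => z x ^+ 2 / wt V x) = fun x => q x ^+ 2.
    by apply/funext => x; rewrite /q exprMn w2.
  have ccp : cc p.
    apply: ccMr; first exact: Cc_inf_cc.
    by move=> x; apply: continuousM; [exact: cw|exact: cwt].
  have ccq : cc q by exact: ccMr.
  have cp := cc_cont ccp; have cq := cc_cont ccq.
  by apply: intR_CS; apply: integrable_cc; rewrite ?expr2; exact: ccM.
rewrite /nrm2 !ipE E.
have -> : (fun x => f x * f x * wt V x) = fun x => f x ^+ 2 * wt V x by apply/funext => x; rewrite expr2.
have -> : (fun x => derive1 phi x * derive1 phi x * wt V x) = fun x => derive1 phi x ^+ 2 * wt V x.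
  by apply/funext => x; rewrite expr2.
set A := intR _; set B := intR (fun x => f x ^+ 2 * _); set C := intR _.
have -> : c * (- A / Zc V) ^+ 2 = c * A ^+ 2 / Zc V ^+ 2 by field.
have -> : B / Zc V * (C / Zc V) = B * C / Zc V ^+ 2 by field.
rewrite ler_pM2r; last by rewrite invr_gt0 exprn_gt0// Zc_gt0.
apply: (le_trans (ler_wpM2l c0 cs)).
rewrite mulrCA mulrC ler_wpM2r//.
by apply: intR_ge0 => x; rewrite mulr_ge0 ?sqr_ge0 ?wt_ge0.
Qed.

End LowerBound.

(** * The Schroedinger form and positivity of the spectral gap *)

Section SpectralGap.
Variable R : realType.
Variable V : R -> R.
Hypothesis sV : smooth V.
Hypothesis iwt : integrableR (wt V).
Implicit Types (f g h : R -> R).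

Let cV : continuous V. Proof. exact: smooth_cont. Qed.
Let cwt : continuous (wt V). Proof. exact: continuous_wt. Qed.
Let Zc0 : Zc V != 0. Proof. by rewrite gt_eqF// Zc_gt0. Qed.

Definition ewt x := expR (V x / 2).

Lemma ewt_gt0 x : 0 < ewt x. Proof. exact: expR_gt0. Qed.

Lemma ewt2 x : ewt x ^+ 2 * wt V x = 1.
Proof. by rewrite /ewt /wt expr2 -!expRD [X in expR X](_ : _ = 0) ?expR0//; field. Qed.

Lemma ewt_deriv : has_deriv ewt (fun x => derive1 V x / 2 * ewt x).
Proof.
move=> x; have hV := smooth_deriv sV x.
have hN : is_derive x (1 : R) (fun y => V y / 2) (derive1 V x / 2).
  have -> : (fun y => V y / 2) = fun y => (2^-1 : R) *: V y.
    by apply/funext => y; rewrite mulrC.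
  by apply: is_derive_eq; rewrite /GRing.scale/= mulrC.
have := @is_derive1_comp R expR (fun y => V y / 2) x _ _ (is_derive_expR (V x / 2)) hN.
by rewrite mulrC.
Qed.

Lemma continuous_ewt : continuous ewt.
Proof. exact: has_deriv_cont ewt_deriv. Qed.

(* [u = e^(V/2) z] conjugates the partner of [- L] to the Schroedinger operator with potential [Wfun V] *)
Section Conjugate.
Variables (f z : R -> R).
Hypotheses (hf : cc f) (hz : has_deriv z (fun x => f x * wt V x)) (cz : cc z).
Let u x := ewt x * z x.
Let u' x := derive1 V x / 2 * u x + ewt x * (f x * wt V x).

Lemma conj_deriv : has_deriv u u'.
Proof.
move=> x; have H1 := ewt_deriv x; have H2 := hz x; apply: is_derive_eq.
by rewrite /u' /u /GRing.scale/=; ring.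
Qed.

Lemma conj_sqr x : u x ^+ 2 = z x ^+ 2 / wt V x.
Proof.
have h := ewt2 x; have w0 : wt V x != 0 by rewrite gt_eqF// wt_gt0.
apply: (mulIf w0); rewrite divfK// /u exprMn.
by rewrite mulrAC h mul1r.
Qed.

Lemma conj_fwt x : f x ^+ 2 * wt V x = (u' x - derive1 V x / 2 * u x) ^+ 2.
Proof.
rewrite /u' addrC addKr !exprMn.
transitivity (f x ^+ 2 * wt V x * (ewt x ^+ 2 * wt V x)); last by ring.
by rewrite ewt2 mulr1.
Qed.

Lemma cc_conj : cc u.
Proof. by apply: ccM => //; exact: continuous_ewt. Qed.

Lemma cc_conj' : cc u'.
Proof.
apply: ccD; apply: ccM.
- move=> x; apply: continuousM; last exact: cvg_cst.
  by apply: smooth_cont; exact: smooth_derive1.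
- exact: cc_conj.
- exact: continuous_ewt.
- by apply: ccMr.
Qed.

End Conjugate.

Lemma W_smooth : smooth (Wfun V).
Proof.
have s1 := smooth_derive1 sV.
have -> : Wfun V = fun x => derive1 (derive1 V) x * 2^-1 + derive1 V x * derive1 V x * 4^-1.
  by apply/funext => x; rewrite /Wfun expr2.
exact: (smoothD (smoothM (smooth_derive1 s1) (@smooth_cst R _)) (smoothM (smoothM s1 s1) (@smooth_cst R _))).
Qed.

Lemma W_cont : continuous (Wfun V).
Proof. exact: smooth_cont W_smooth. Qed.

(** By [conj_fwt] the left integrand is [(u' - V'/2 u) ^ 2]. Its cross term [- V' u u'] equals
    [V''/2 u ^ 2] up to the derivative of [- V' u ^ 2 / 2], which completes the potential
    [Wfun V]. *)
Lemma conj_energy f z : cc f -> has_deriv z (fun x => f x * wt V x) -> cc z ->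
  let u x := ewt x * z x in
  let u' x := derive1 V x / 2 * u x + ewt x * (f x * wt V x) in
  intR (fun x => f x ^+ 2 * wt V x) = intR (fun x => u' x ^+ 2 + Wfun V x * u x ^+ 2).
Proof.
move=> hf hz cz u u'.
have du : has_deriv u u' by exact: conj_deriv.
have ccu : cc u by exact: cc_conj.
have ccu' : cc u' by exact: cc_conj'.
have cu := cc_cont ccu; have cu' := cc_cont ccu'.
have cW := W_cont.
have d1 := smooth_deriv2 sV.
have cc1 : cc (fun x => u' x ^+ 2 + Wfun V x * u x ^+ 2).
  by apply: ccD; [exact: ccX2|apply: ccM => //; exact: ccX2].
have cc2 : cc (fun x => f x ^+ 2 * wt V x) by apply: ccMr => //; exact: ccX2.
apply/eqP; rewrite -subr_eq0 -intRB; [|exact: integrable_cc..].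
apply/eqP; apply: (@intR_deriv0 _ (fun x => - 2^-1 * (derive1 V x * u x ^+ 2))).
- apply: has_deriv_eq (has_derivZ (- 2^-1) (has_derivM d1 (has_derivX2 du))) _ _ => // x.
  by rewrite (conj_fwt f z) -/(u x) -/(u' x) /Wfun; field.
- exact: ccB.
- have [a [b h]] := cz.2; exists a, b => x hx.
  by rewrite /u h// mulr0 expr0n !mulr0.
Qed.

(* Outside a bounded set [Wfun V >= 1], where the potential controls [u ^ 2]; in the middle
   [z ^ 2 <= Zc V * intR (f ^ 2 wt)] does. *)
Lemma lam1_gt0 (kappa : R) : 0 < kappa ->
  (forall x, 2 * kappa ^+ 2 <= derive1n 2 (Wfun V) x) ->
  exists2 c : R, 0 < c & (c%:E <= lam V 1)%E.
Proof.
move=> k0 hW.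
have sW := W_smooth; have dW := smooth_deriv sW; have dW2 := smooth_deriv2 sW.
pose W0 := Wfun V 0; pose W1 := derive1 (Wfun V) 0.
have lowW x : W0 + W1 * x + kappa ^+ 2 * x ^+ 2 <= Wfun V x.
  have dq : has_deriv (fun x => Wfun V x - kappa ^+ 2 * x ^+ 2) (fun x => derive1 (Wfun V) x - 2 * kappa ^+ 2 * x).
    apply: has_deriv_eq (has_derivD dW (has_derivZ (- kappa ^+ 2) (has_derivX2 has_deriv_id))) _ _ => y /=; ring.
  have dq2 : has_deriv (fun x => derive1 (Wfun V) x - 2 * kappa ^+ 2 * x) (fun x => derive1n 2 (Wfun V) x - 2 * kappa ^+ 2).
    apply: has_deriv_eq (has_derivD dW2 (has_derivZ (- 2 * kappa ^+ 2) has_deriv_id)) _ _ => y /=; ring.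
  have hpos y : 0 <= derive1n 2 (Wfun V) y - 2 * kappa ^+ 2 by rewrite subr_ge0.
  have := tangent_le dq dq2 hpos 0 x.
  by rewrite expr0n /= !mulr0 !subr0 -/W0 -/W1; lra.
(* Beyond [B] one has [|x| >= 1] and [kappa ^ 2 * |x| >= |W0| + |W1| + 1], so the quadratic term in
   [lowW] outweighs the affine one by at least 1. *)
pose B := (`|W0| + `|W1| + 1) / kappa ^+ 2 + 1.
have k2 : 0 < kappa ^+ 2 by rewrite exprn_gt0.
have hB x : B < `|x| -> 1 <= Wfun V x.
  move=> hx; apply: le_trans (lowW x).
  have B1 : 1 <= B by rewrite /B lerDr divr_ge0 ?ltW// !addr_ge0.
  have x1 : 1 <= `|x| by lra.
  have : `|W0| + `|W1| + 1 <= kappa ^+ 2 * `|x|.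
    have : (`|W0| + `|W1| + 1) / kappa ^+ 2 <= `|x| by rewrite /B in hx; lra.
    by rewrite ler_pdivrMr// mulrC.
  have n0 := ler_norm (- W0); have n1 := ler_norm (- (W1 * x)).
  rewrite !normrN normrM in n0 n1.
  rewrite -(real_normK (num_real x)).
  have := normr_ge0 W0; have := normr_ge0 W1; nra.
(* As [u ^ 2 = z ^ 2 / wt], the defect [max (1 - Wfun V) 0 * u ^ 2] is [m * z ^ 2], and [m] is
   integrable by compactness of its support. *)
pose m x := Num.max (1 - Wfun V x) 0 / wt V x.
have m0 x : 0 <= m x by rewrite /m divr_ge0 ?wt_ge0// le_max lexx orbT.
have cwtV : continuous (fun x => (wt V x)^-1).
  by apply: has_deriv_cont; apply: has_derivV (wt_deriv sV) _ => x; rewrite gt_eqF// wt_gt0.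
have ccm : cc m.
  apply: ccMr => //; split.
    move=> x; apply: (@continuous_max _ _ (fun x => 1 - Wfun V x) (fun=> 0)); last exact: cvg_cst.
    by apply: continuousB; [exact: cvg_cst|exact: W_cont].
  exists (- B), B => x hx; apply/max_idPr; rewrite subr_le0; apply: hB.
  by rewrite ltr_normr; case: hx => ?; apply/orP; [right|left] => //; lra.
pose M := Zc V * intR m.
have M0 : 0 <= M by apply: mulr_ge0; [exact: Zc_ge0|exact: intR_ge0].
have key f z : cc f -> has_deriv z (fun x => f x * wt V x) -> cc z ->
    intR (fun x => z x ^+ 2 / wt V x) <= (1 + M) * intR (fun x => f x ^+ 2 * wt V x).
  move=> hf hz cz; pose Q := intR (fun x => f x ^+ 2 * wt V x).
  (* [z x] is the integral of [f * wt] over the ray up to [x], so Cauchy-Schwarz against an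
     indicator bounds it uniformly in [x]. *)
  have zQ x : z x ^+ 2 <= Q * Zc V.
    have -> : z x = Zc V * ip V f (\1_[set` `]-oo, x]]).
      by rewrite -ip_indic// (ftc_ray x hz)//; [exact: ccMr|exact: cz.2].
    have hq := ip_indic_le sV iwt `]-oo, x] (L2_cc cV hf).
    have -> : Q * Zc V = Zc V ^+ 2 * nrm2 V f by rewrite /Q nrm2_intR//; ring.
    by rewrite exprMn ler_wpM2l ?sqr_ge0.
  have e1 : (fun x => z x ^+ 2 / wt V x) = fun x => (ewt x * z x) ^+ 2.
    by apply/funext => x; rewrite conj_sqr.
  have ccu := cc_conj cz; have ccu' := cc_conj' hf cz.
  have i1 : integrableR (fun x => m x * (Q * Zc V)).
    by apply: integrable_cc; apply: ccMr => // x; exact: cvg_cst.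
  have i2 : integrableR (fun x => (derive1 V x / 2 * (ewt x * z x) + ewt x * (f x * wt V x)) ^+ 2 + Wfun V x * (ewt x * z x) ^+ 2).
    by apply: integrable_cc; apply: ccD; [exact: ccX2|apply: ccM; [exact: W_cont|exact: ccX2]].
  have := le_intR _ (integrableRD i2 i1) (_ : forall x, (ewt x * z x) ^+ 2 <= _).
  rewrite -e1 intRD// -(conj_energy hf hz cz) -/Q => H.
  apply: le_trans (H _ _) _.
  - by rewrite e1; apply: integrable_cc; exact: ccX2.
  - move=> x; have h0 := sqr_ge0 (derive1 V x / 2 * (ewt x * z x) + ewt x * (f x * wt V x)).
    have hm : (1 - Wfun V x) * (ewt x * z x) ^+ 2 <= m x * (Q * Zc V).
      rewrite conj_sqr; apply: (@le_trans _ _ (Num.max (1 - Wfun V x) 0 * (z x ^+ 2 / wt V x))).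
        by rewrite ler_wpM2r ?divr_ge0 ?sqr_ge0 ?wt_ge0// le_max lexx.
      by rewrite mulrA mulrAC -/(m x) ler_wpM2l.
    by lra.
  - have -> : intR (fun x => m x * (Q * Zc V)) = intR (fun x => (Q * Zc V) * m x) by apply: intR_ext => x; exact: mulrC.
    by rewrite intRZ ?integrable_cc// /M; lra.
pose b0 := @hat R; have ccb : cc b0 := @cc_hat R; have b00 x : 0 <= b0 x := hat_ge0 x.
have ib : 0 < ip V b0 (fun=> 1).
  rewrite ipE divr_gt0 ?Zc_gt0//; apply: (@intR_gt0 _ _ 0).
  - by apply: contM => //; apply: contM; [exact: cc_cont|move=> x; exact: cvg_cst].
  - by apply: L2_mul => //; [exact: L2_cc|exact: L2_cst].
  - by move=> x; rewrite mulr1 mulr_ge0 ?wt_ge0.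
  - by rewrite mulr1 mulr_gt0 ?wt_gt0// /b0 hat0.
exists (1 + M)^-1; first by rewrite invr_gt0; lra.
apply: (@lam_ge _ _ _ _ 1 _ (fun=> fun=> 1) (fun _ x => (ip V b0 (fun=> 1))^-1 * b0 x)) => //.
- by move=> _ _; exact: L2_cst.
- by move=> _ _; exact: ccZ.
- move=> i j; rewrite !ltnS !leqn0 => /eqP -> /eqP ->.
  rewrite (ipZl cV _ (L2_cc cV ccb) (L2_cst cV iwt 1)).
  by rewrite mulVf// gt_eqF.
move=> f hf /(_ 0%N isT) f1.
have fw : cc (fun x => f x * wt V x) by exact: ccMr.
have [|z [hz cz]] := cc_primitive fw.
  move: f1; rewrite ipE => /eqP; rewrite mulf_eq0 invr_eq0 (negbTE Zc0) orbF => /eqP <-.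
  by apply: intR_ext => x; rewrite mulr1.
apply: (duality_ineq sV iwt hf hz cz); first by rewrite invr_ge0; lra.
rewrite mulrC ler_pdivrMr; last by rewrite ltr_wpDr.
by rewrite mulrC; exact: (key f z hf hz cz).
Qed.

End SpectralGap.

(** * Regularity of the first eigenfunction *)

Section Regularity.
Variable R : realType.
Variable V : R -> R.
Hypothesis sV : smooth V.
Hypothesis iwt : integrableR (wt V).
Implicit Types (f g h F P : R -> R).

Let cV : continuous V. Proof. exact: smooth_cont. Qed.
Let cwt : continuous (wt V). Proof. exact: continuous_wt. Qed.
Let Zc0 : Zc V != 0. Proof. by rewrite gt_eqF// Zc_gt0. Qed.
Let wt0 x : wt V x != 0. Proof. by rewrite gt_eqF// wt_gt0. Qed.

Lemma continuous_invwt : continuous (fun x => (wt V x)^-1).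
Proof. exact: has_deriv_cont (has_derivV (wt_deriv sV) wt0). Qed.

(** Both [G - F] and [G + F] are nondecreasing. *)
Lemma deriv_le_abs F f G g : has_deriv F f -> has_deriv G g ->
  (forall x, `|f x| <= g x) -> forall x y, `|F x - F y| <= `|G x - G y|.
Proof.
move=> hF hG h.
have aux x y : x <= y -> `|F x - F y| <= `|G x - G y|.
  move=> xy; rewrite (distrC (F x)) (distrC (G x)).
  have d1 : has_deriv (fun x => G x - F x) (fun x => g x - f x).
    apply: has_deriv_eq (has_derivD hG (has_derivZ (-1) hF)) _ _ => t; ring.
  have m1 := deriv_ge0_le (fun t _ => d1 t) _ xy.
  have m2 := deriv_ge0_le (fun t _ => has_derivD hG hF t) _ xy.
  have {}m1 : G x - F x <= G y - F y.
    by apply: m1 => t _; have := h t; rewrite ler_norml; lra.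
  have {}m2 : G x + F x <= G y + F y.
    by apply: m2 => t _; have := h t; rewrite ler_norml; lra.
  rewrite (@ger0_norm _ (G y - G x)); last by lra.
  by rewrite ler_norml; lra.
move=> x y; have [|/ltW yx] := leP x y; first exact: aux.
by rewrite (distrC (F x)) (distrC (G x)); exact: aux.
Qed.

Lemma continuous_uniform_limit (p : nat -> R -> R) P (e : nat -> R) :
  (forall k, continuous (p k)) -> (forall k x, `|p k x - P x| <= e k) ->
  e @ \oo --> (0 : R) -> continuous P.
Proof.
move=> cp pe ce x; apply/cvgrPdist_lt => eps eps0.
have e3 : 0 < eps / 3 by rewrite divr_gt0.
have [k hk] : exists k, e k < eps / 3.
  have : \forall k \near \oo, e k < eps / 3 by exact: (cvgr_lt _ ce).
  by move=> [N _ hN]; exists N; exact: hN (leqnn N).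
have : \forall y \near x, `|p k x - p k y| < eps / 3.
  by move/cvgrPdist_lt: (cp k x); exact.
apply: filterS => y hy.
have h1 := pe k x; have h2 := pe k y.
move: hy h1 h2; rewrite ltr_norml !ler_norml ltr_norml => /andP[? ?] /andP[? ?] /andP[? ?].
by apply/andP; split; lra.
Qed.

Lemma intR_ray_diff h x y : continuous h -> integrableR h -> x <= y ->
  intR (h \_ `]-oo, y]) - intR (h \_ `]-oo, x]) = intR (h \_ `[x, y]).
Proof.
move=> ch ih xy; rewrite /intR -!Rintegral_mkcond.
rewrite (@Rintegral_itvB R h -oo%O (BRight y) x) ?bnd_simp//.
  by rewrite Rintegral_itv_obnd_cbnd//; apply: integrableS ih.
exact: integrableS ih.
Qed.

Section Eigen.
Variables (f g : R -> R) (phi : nat -> R -> R) (r : R).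
Hypotheses (Lf : L2 V f) (Lg : L2 V g).
Hypothesis hphi : forall k, Cc_inf (phi k).
Hypothesis cf : cvL2 V phi f.
Hypothesis cg : cvL2 V (fun k => Lop V (phi k)) g.
Hypothesis eig : nrm2 V (fun x => g x + r * f x) = 0.

(* [p k] is the integral of [Lop V (phi k)] over a ray, hence converges uniformly. *)
Let p k x := derive1 (phi k) x * wt V x.
Let P x := Zc V * ip V g (\1_[set` `]-oo, x]]).
Let e k := Zc V * Num.sqrt (nrm2 V (fun x => Lop V (phi k) x - g x)).

Let Lphi k : L2 V (phi k). Proof. exact: L2_Cc_inf. Qed.
Let LL k : L2 V (Lop V (phi k)). Proof. exact: L2_Lop. Qed.

Let p_deriv k : has_deriv (p k) (fun x => Lop V (phi k) x * wt V x).
Proof.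
have [sk _] := hphi k.
apply: has_deriv_eq (has_derivM (smooth_deriv2 sk) (wt_deriv sV)) _ _ => // x.
by rewrite /Lop; ring.
Qed.

Let p_ip k x : p k x = Zc V * ip V (Lop V (phi k)) (\1_[set` `]-oo, x]]).
Proof.
rewrite -ip_indic// (ftc_ray x (p_deriv k))//.
  by apply: ccMr => //; exact: cc_Lop.
by have [] := ccMr (Cc_inf_cc (Cc_inf_deriv (hphi k))) cwt.
Qed.

Let pP k x : `|p k x - P x| <= e k.
Proof.
rewrite p_ip /P /e -mulrBr normrM (ger0_norm (Zc_ge0 V)) ler_wpM2l ?Zc_ge0//.
rewrite -ipBl//; last exact: L2_indic.
rewrite -sqrtr_sqr ler_sqrt ?nrm2_ge0//.
by apply: ip_indic_le => //; exact: L2B.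
Qed.

Let ce : e @ \oo --> (0 : R).
Proof.
rewrite -(mulr0 (Zc V)); apply: cvgM; first exact: cvg_cst.
rewrite -[X in _ --> X](@sqrtr0 R).
by apply: (continuous_cvg _ _ cg); exact: sqrt_continuous.
Qed.

Let cP : continuous P.
Proof.
apply: (continuous_uniform_limit _ pP ce) => k.
exact: has_deriv_cont (p_deriv k).
Qed.

(** Dividing the uniform bound on [p k - P] by [wt] controls the derivatives of [phi k], hence the
    increments [phi k - phi k 0] locally uniformly. The constants [phi k 0] converge because the
    weighted integrals of [phi k] over [[0, 1]] do, by convergence in [L2]. *)
Lemma eigen_lift : exists F, has_deriv F (fun x => P x / wt V x) /\
  (forall x, (fun k => phi k x) @ \oo --> F x).
Proof.
have cPw : continuous (fun x => P x / wt V x) by exact: contM cP continuous_invwt.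
have [Phi hPhi] := primitive_exists cPw.
have [S hS] := primitive_exists continuous_invwt.
pose d k x := phi k x - phi k 0.
pose D x := Phi x - Phi 0.
have dD k x : `|d k x - D x| <= e k * `|S x - S 0|.
  have [sk _] := hphi k.
  have h1 : has_deriv (fun x => phi k x - Phi x) (fun x => derive1 (phi k) x - P x / wt V x).
    apply: has_deriv_eq (has_derivD (smooth_deriv sk) (has_derivZ (-1) hPhi)) _ _ => t; ring.
  have h2 := has_derivZ (e k) hS.
  have h3 y : `|derive1 (phi k) y - P y / wt V y| <= e k * (wt V y)^-1.
    rewrite (_ : _ - _ = (p k y - P y) / wt V y); last by rewrite /p; field.
    by rewrite normrM (@ger0_norm _ (wt V y)^-1) ?invr_ge0 ?wt_ge0// ler_wpM2r ?invr_ge0 ?wt_ge0.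
  have := deriv_le_abs h1 h2 h3 x 0.
  rewrite -mulrBr normrM (@ger0_norm _ (e k)) ?mulr_ge0 ?sqrtr_ge0 ?Zc_ge0//.
  by rewrite (_ : d k x - D x = phi k x - Phi x - (phi k 0 - Phi 0))//; rewrite /d /D; ring.
have cd x : (fun k => d k x) @ \oo --> D x.
  apply/cvgrPdist_le => eps eps0.
  have : (fun k => e k * `|S x - S 0|) @ \oo --> (0 : R).
    exact: cvg0Mr.
  move/(cvgr_lt _)/(_ eps eps0); apply: filterS => k hk.
  by rewrite distrC (le_trans (dD k x))// ltW.
have cD : continuous D by apply: contD; [exact: has_deriv_cont hPhi|move=> x; exact: cvg_cst].
have cdk k : continuous (d k).
  apply: contD; last by move=> x; exact: cvg_cst.
  by apply: smooth_cont; have [] := hphi k.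
pose J : interval R := `[0, 1].
pose m := intR (wt V \_ [set` J]).
have m0 : 0 < m.
  have [G hG] := primitive_exists cwt.
  rewrite /m (ftc_itv ler01 hG cwt) subr_gt0.
  by apply: (deriv_gt0_lt (fun x _ => hG x)); [move=> x _; exact: wt_gt0|exact: ltr01].
have cI : (fun k => intR ((fun x => d k x * wt V x) \_ [set` J])) @ \oo --> intR ((fun x => D x * wt V x) \_ [set` J]).
  apply/cvgrPdist_le => eps eps0.
  have : (fun k => e k * `|S 1 - S 0| * m) @ \oo --> (0 : R).
    by apply: cvg0Mr; exact: cvg0Mr.
  move/(cvgr_lt _)/(_ eps eps0); apply: filterS => k hk.
  apply: le_trans (ltW hk).
  have i1 : integrableR ((fun x => D x * wt V x) \_ [set` J]) by apply: integrable_itv; exact: contM.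
  have i2 : integrableR ((fun x => d k x * wt V x) \_ [set` J]) by apply: integrable_itv; exact: contM.
  rewrite -intRB//; apply: (le_trans (normr_intR (integrableRB i1 i2))).
  rewrite /m -intRZ; last exact: integrable_itv.
  apply: le_intR.
  - by apply: integrableR_norm; exact: integrableRB.
  - by apply: integrableRZ; exact: integrable_itv.
  move=> x; rewrite !patchE; case: ifPn => xJ; last by rewrite subrr normr0 mulr0.
  rewrite -mulrBl normrM (ger0_norm (wt_ge0 V x)) ler_wpM2r ?wt_ge0// distrC.
  apply: (le_trans (dD k x)); rewrite ler_wpM2l ?mulr_ge0 ?sqrtr_ge0 ?Zc_ge0//.
  move: xJ; rewrite mem_setE in_itv/= => /andP[x0 x1].
  have mS a b : a <= b -> S a <= S b.
    by apply: (deriv_ge0_le (fun t _ => hS t)) => t _; rewrite invr_ge0 wt_ge0.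
  by rewrite !ger0_norm ?subr_ge0 ?mS// lerD2r mS.
have cA : (fun k => phi k 0) @ \oo --> (Zc V * ip V f (\1_[set` J]) - intR ((fun x => D x * wt V x) \_ [set` J])) / m.
  have E k : phi k 0 = (Zc V * ip V (phi k) (\1_[set` J]) - intR ((fun x => d k x * wt V x) \_ [set` J])) / m.
    apply: (mulIf (lt0r_neq0 m0)); rewrite divfK ?lt0r_neq0//.
    rewrite -ip_indic// -intRB; last 2 first.
    - by apply: integrable_itv; apply: contM => //; apply: smooth_cont; have [] := hphi k.
    - by apply: integrable_itv; exact: contM.
    rewrite /m -intRZ; last exact: integrable_itv.
    apply: intR_ext => x; rewrite !patchE; case: ifPn => xJ; last by rewrite subrr mulr0.
    by rewrite /d; ring.
  under eq_fun do rewrite E.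
  apply: cvgM; last exact: cvg_cst.
  apply: cvgB => //; apply: cvgM; first exact: cvg_cst.
  apply: cvg_ip => //; try by move=> *; exact: L2_indic.
  exact: cvL2_cst.
set c := (X in _ --> X) in cA.
exists (fun x => c + D x); split.
  apply: has_deriv_eq (has_derivD (has_deriv_cst (c - Phi 0)) hPhi) _ _ => x; last by rewrite add0r.
  by rewrite /D; ring.
move=> x; rewrite (_ : (fun k => phi k x) = fun k => phi k 0 + d k x).
  by apply: cvgD => //; exact: cd.
by apply/funext => k; rewrite /d; ring.
Qed.

(** The eigenvalue equation is used in integrated form: [P] is the ray integral of [g * wt], in
    which [g] may be replaced by [- r * F]; continuity of [F] then makes [P] differentiable. The
    derivative [P / wt] of [F] lies in [L2] by Fatou, because the energies of [phi k] are
    [- ip (phi k) (Lop (phi k))] and converge. The mean of [r * F] vanishes because that of every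
    [Lop V (phi k)] does. *)
Lemma eigen_regular : exists F P, [/\ has_deriv F (fun x => P x / wt V x),
  has_deriv P (fun x => - r * (F x * wt V x)), L2 V F,
  nrm2 V (fun x => f x - F x) = 0 &
  [/\ L2 V (fun x => P x / wt V x), r * intR (fun x => F x * wt V x) = 0 &
   forall x, P x = - r * intR ((fun x => F x * wt V x) \_ `]-oo, x])]].
Proof.
have [F [hF cphiF]] := eigen_lift.
have cFc : continuous F := has_deriv_cont hF.
have Lfk k : L2 V (fun x => phi k x - f x) by exact: L2B.
(* Fatou for the squared distances to [f], whose integrals tend to 0, identifies the pointwise limit
   [F] with the [L2] limit [f]. *)
have [i1 i2] : integrableR (fun x => (F x - f x) ^+ 2 * wt V x) /\
    intR (fun x => (F x - f x) ^+ 2 * wt V x) <= 0.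
  apply: (@fatou_intR _ (fun k x => (phi k x - f x) ^+ 2 * wt V x)).
  - by move=> k; exact: L2_int.
  - by move=> k x; rewrite mulr_ge0 ?sqr_ge0 ?wt_ge0.
  - move=> x; apply: cvgM; last exact: cvg_cst.
    rewrite expr2; under eq_fun do rewrite expr2.
    by apply: cvgM; apply: cvgB => //; exact: cvg_cst.
  - have -> : (fun k => intR (fun x => (phi k x - f x) ^+ 2 * wt V x)) =
        (fun k => nrm2 V (fun x => phi k x - f x) * Zc V).
      by apply/funext => k; exact: (nrm2_intR sV iwt (fun x => phi k x - f x)).
    exact: cvg0Mr.
have mF : measurable_fun setT F by exact: measurable_cont.
have LFf : L2 V (fun x => F x - f x).
  apply/(L2P cV); split; last exact: i1.
  by apply: measurable_funB; [exact: mF|exact: (L2_measurable Lf)].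
have LF : L2 V F.
  rewrite (_ : F = fun x => f x + (F x - f x)); first exact: L2D.
  by apply/funext => x; ring.
have nF : nrm2 V (fun x => f x - F x) = 0.
  apply/eqP; rewrite eq_le nrm2_ge0 andbT /nrm2 ipE ler_pdivrMr ?Zc_gt0// mul0r.
  rewrite (@intR_ext _ _ (fun x => (F x - f x) ^+ 2 * wt V x))// => x; ring.
have ipfF h : L2 V h -> ip V f h = ip V F h.
  move=> Lh; apply/eqP; rewrite -subr_eq0 -ipBl//; apply/eqP.
  by apply: ip_eq0 => //; exact: L2B.
have ipg h : L2 V h -> ip V g h = - r * ip V F h.
  move=> Lh; have Lrf : L2 V (fun x => r * f x) by exact: L2Z.
  have := ip_eq0 cV (L2D cV Lg Lrf) Lh eig.
  rewrite ipDl// ipZl// ipfF// => /eqP; rewrite addr_eq0 => /eqP ->.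
  by rewrite mulNr.
have iFw : integrableR (fun x => F x * wt V x).
  apply: integrableR_ext (L2_mul cV LF (L2_cst cV iwt 1)) => x.
  by rewrite mulr1.
have PE x : P x = - r * intR ((fun x => F x * wt V x) \_ `]-oo, x]).
  by rewrite /P ipg ?ip_indic//; [ring|exact: L2_indic].
exists F, P; split => //; last split => //.
- have [G hG] := primitive_exists (contM cFc cwt).
  have dif x y : x <= y -> P y - P x = - r * (G y - G x).
    move=> xy; rewrite !PE -mulrBr intR_ray_diff//; last exact: contM.
    by rewrite (ftc_itv xy hG)//; exact: contM.
  have E x : P x = P 0 + - r * (G x - G 0).
    by have [/dif <-|/ltW /dif h] := leP 0 x; [ring|rewrite -opprB mulrN -h; ring].
  apply: has_deriv_eq (has_derivD (has_deriv_cst (P 0 + r * G 0)) (has_derivZ (- r) hG)) _ _ => x.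
    by rewrite [RHS]E; ring.
  by rewrite add0r.
- apply/(L2P cV); split.
    by apply: measurable_cont; exact: contM cP continuous_invwt.
  have Ld k : L2 V (derive1 (phi k)) by exact: (L2_Cc_inf sV (Cc_inf_deriv (hphi k))).
  have [] // := @fatou_intR _ (fun k x => derive1 (phi k) x ^+ 2 * wt V x)
    (fun x => (P x / wt V x) ^+ 2 * wt V x) (- ip V f g * Zc V).
  - by move=> k; exact: L2_int.
  - by move=> k x; rewrite mulr_ge0 ?sqr_ge0 ?wt_ge0.
  - move=> x; apply: cvgM; last exact: cvg_cst.
    have cd : (fun k => derive1 (phi k) x) @ \oo --> P x / wt V x.
      have -> : (fun k => derive1 (phi k) x) = fun k => p k x / wt V x.
        by apply/funext => k; rewrite /p mulfK.
      apply: cvgM; last exact: cvg_cst.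
      apply/cvgrPdist_le => eps eps0; move/(cvgr_lt _): ce => /(_ eps eps0).
      by apply: filterS => k hk; rewrite distrC (le_trans (pP k x))// ltW.
    by rewrite expr2; under eq_fun do rewrite expr2; exact: cvgM.
  - have -> : (fun k => intR (fun x => derive1 (phi k) x ^+ 2 * wt V x)) =
        (fun k => - ip V (phi k) (Lop V (phi k)) * Zc V).
      by apply/funext => k; rewrite ip_Lop// opprK nrm2_intR.
    apply: cvgM; last exact: cvg_cst.
    by apply: cvgN; exact: cvg_ip.
- have L1 : L2 V (fun=> 1) by exact: L2_cst.
  have z k : ip V (Lop V (phi k)) (fun=> 1) = 0.
    rewrite ipE (@intR_ext _ _ (fun x => Lop V (phi k) x * wt V x)); last by move=> x; rewrite mulr1.
    have cw := ccMr (cc_Lop sV (hphi k)) cwt.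
    rewrite (intR_deriv0 (p_deriv k) cw) ?mul0r//.
    by have [] := ccMr (Cc_inf_cc (Cc_inf_deriv (hphi k))) cwt.
  have : ip V g (fun=> 1) = 0.
    have := cvg_ip cV LL (fun=> L1) Lg L1 cg (cvL2_cst V (fun=> 1)).
    under eq_fun do rewrite z.
    by move=> h; apply/esym; apply: (cvg_unique _ (@cvg_cst _ 0 _ \oo _) h).
  rewrite ipg// => /eqP; rewrite mulNr oppr_eq0 ipE mulrA mulf_eq0 invr_eq0 (negbTE Zc0) orbF => /eqP.
  by rewrite (@intR_ext _ _ (fun x => F x * wt V x))// => x; rewrite mulr1.
Qed.

End Eigen.
End Regularity.

(** * Log-concavity of the ground state *)

Section LogConcave.
Variable R : realType.
Implicit Types (f g h G psi : R -> R).

(** A window of length [(intR f + 1) / c] already carries more than the whole integral. Windows of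
    every length are required instead of a half-line so that both ends of the line are covered. *)
Lemma not_integrable_lower_bound f (c : R) : 0 < c -> integrableR f -> (forall x, 0 <= f x) ->
  (forall M : R, 0 <= M -> exists b : R, forall x : R, b <= x <= b + M -> c <= f x) -> False.
Proof.
move=> c0 itf f0 H; pose M := (intR f + 1) / c.
have M0 : 0 <= M by rewrite divr_ge0 ?(ltW c0)// addr_ge0// intR_ge0.
have [b hb] := H M M0.
have cc' : continuous (fun _ : R => c) by move=> x; exact: cvg_cst.
have dc : has_deriv (fun x => c * x) (fun=> c).
  by apply: has_deriv_eq (has_derivZ c has_deriv_id) _ _ => // x; rewrite mulr1.
have bM : b <= b + M by rewrite lerDl.
have h1 := ftc_itv bM dc cc'.
have : intR ((fun=> c) \_ `[b, b + M]) <= intR f.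
  apply: le_intR => //; first exact: integrable_itv.
  by move=> x; rewrite patchE; case: ifPn => //; rewrite mem_setE in_itv/= => /hb.
rewrite h1 -mulrBr addrAC subrr add0r /M mulrC divfK ?gt_eqF//.
by move=> ?; lra.
Qed.

Section Side.
Variables (psi h G G1 G2 : R -> R) (kappa x0 : R).
Hypothesis k0 : 0 < kappa.
Hypothesis dpsi : has_deriv psi (fun x => - h x * psi x).
Hypothesis dh : has_deriv h (fun x => h x ^+ 2 - G x).
Hypothesis dG : has_deriv G G1.
Hypothesis dG1 : has_deriv G1 G2.
Hypothesis hG2 : forall x, 2 * kappa ^+ 2 <= G2 x.
Hypothesis psi0 : forall x, 0 < psi x.
Hypothesis hx0 : h x0 ^+ 2 - G x0 < kappa.
Hypothesis hx1 : 2 * h x0 * kappa <= G1 x0.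

(* The Gaussian [gam] solves the Schroedinger equation of a harmonic oscillator that touches [G] from
   below at [x0]; the Wronskian [om] of [psi] and [gam] then increases to the right of [x0]. *)
Lemma growth_side : exists c, 0 < c /\ exists N, forall x, N <= x -> c <= psi x.
Proof.
have k2 : 0 < 2 * kappa by rewrite mulr_gt0.
have k12 : 0 < 1 + 2 * kappa by rewrite addr_gt0.
pose b := h x0.
pose l x := b + kappa * (x - x0).
pose q x := b * (x - x0) + kappa / 2 * (x - x0) ^+ 2.
pose gam x := expR (- q x).
pose e x := expR (q x).
have dx : has_deriv (fun x => x - x0) (fun=> 1).
  apply: has_deriv_eq (has_derivD has_deriv_id (has_deriv_cst (- x0))) _ _ => // x.
  by rewrite addr0.
have dl : has_deriv l (fun=> kappa).
  apply: has_deriv_eq (has_derivD (has_deriv_cst b) (has_derivZ kappa dx)) _ _ => // x.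
  by rewrite add0r mulr1.
have dq : has_deriv q l.
  apply: has_deriv_eq (has_derivD (has_derivZ b dx) (has_derivZ (kappa / 2) (has_derivX2 dx))) _ _ => // x.
  by rewrite /l; field.
have de : has_deriv e (fun x => l x * e x) := has_deriv_expR dq.
have dgam : has_deriv gam (fun x => - l x * gam x).
  apply: has_deriv_expR; apply: has_deriv_eq (has_derivZ (-1) dq) _ _ => x; ring.
have ge x : gam x * e x = 1 by rewrite /gam /e -expRD addNr expR0.
have g0 x : 0 < gam x by exact: expR_gt0.
have e0 x : 0 < e x by exact: expR_gt0.
(* [l] is to [gam] what [h] is to [psi], and [l ^ 2 - kappa] is the oscillator potential, so [K] is
   the difference of the two potentials. At [x0] it is positive by [hx0] with nonnegative slope by
   [hx1]; it is convex by [hG2], hence positive to the right of [x0]. *)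
pose K x := G x - l x ^+ 2 + kappa.
have dK : has_deriv K (fun x => G1 x - 2 * kappa * l x).
  apply: has_deriv_eq (has_derivD (has_derivD dG (has_derivZ (-1) (has_derivX2 dl))) (has_deriv_cst kappa)) _ _ => x; rewrite /K; ring.
have dK1 : has_deriv (fun x => G1 x - 2 * kappa * l x) (fun x => G2 x - 2 * kappa ^+ 2).
  apply: has_deriv_eq (has_derivD dG1 (has_derivZ (- 2 * kappa) dl)) _ _ => x; ring.
have lx0 : l x0 = b by rewrite /l subrr mulr0 addr0.
have K0 : 0 < K x0 by rewrite /K lx0 /b; move: hx0; lra.
have Kpos x : x0 <= x -> 0 < K x.
  move=> xx; have hp y : 0 <= G2 y - 2 * kappa ^+ 2 by rewrite subr_ge0.
  have := tangent_le dK dK1 hp x0 x; rewrite lx0; apply: lt_le_trans.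
  rewrite ltr_wpDr// mulr_ge0 ?subr_ge0//.
  by move: hx1; rewrite /b; lra.
pose om x := psi x * gam x * (l x - h x).
have dom : has_deriv om (fun x => K x * (psi x * gam x)).
  apply: has_deriv_eq (has_derivM (has_derivM dpsi dgam) (has_derivD dl (has_derivZ (-1) dh))) _ _ => x; rewrite /om /K; ring.
have om0 : om x0 = 0 by rewrite /om lx0 /b subrr mulr0.
pose x1 := x0 + 1.
have om1 : 0 < om x1.
  rewrite -om0; apply: (deriv_gt0_lt (fun x _ => dom x)); last by rewrite /x1; lra.
  by move=> x /andP[xx _]; rewrite mulr_gt0 ?Kpos// mulr_gt0.
have omx x : x1 <= x -> om x1 <= om x.
  apply: (deriv_ge0_le (fun x _ => dom x)) => t /andP[tx _].
  by rewrite mulr_ge0 ?ltW ?mulr_gt0 ?Kpos//; move: tx; rewrite /x1; lra.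
(* [C] bounds [l * gam]: since [q] is [(l ^ 2 - b ^ 2) / (2 * kappa)], [gam] is
   [expR (b ^ 2 / (2 * kappa)) / expR t] with [t = l ^ 2 / (2 * kappa)], and [l <= 1 + l ^ 2 <= (1 +
   2 * kappa) * (1 + t)]. *)
pose C := expR (b ^+ 2 / (2 * kappa)) * (1 + 2 * kappa).
have C0 : 0 < C by rewrite mulr_gt0 ?expR_gt0.
have lgam x : l x * gam x <= C.
  have [l0|l0] := leP (l x) 0; first by apply: le_trans (ltW C0); rewrite mulr_le0_ge0// ltW.
  pose t := l x ^+ 2 / (2 * kappa).
  have t0 : 0 <= t by rewrite /t divr_ge0 ?sqr_ge0// ltW.
  have -> : gam x = expR (b ^+ 2 / (2 * kappa)) / expR t.
    rewrite -expRN -expRD /gam; congr expR; rewrite /q /t /l; field.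
    by rewrite gt_eqF.
  rewrite mulrCA /C ler_wpM2l ?expR_ge0// ler_pdivrMr ?expR_gt0//.
  have h1 : 1 + t <= expR t by exact: expR_ge1Dx.
  apply: (@le_trans _ _ ((1 + 2 * kappa) * (1 + t))); last by rewrite ler_wpM2l// ltW.
  have ht : 2 * kappa * t = l x ^+ 2 by rewrite /t; field; rewrite gt_eqF.
  have kt : 0 <= kappa * t by rewrite mulr_ge0// ltW.
  by have := sqr_ge0 (l x - 1); nra.
(* The first bound makes [(psi - c) * e] nondecreasing beyond [x1], as its derivative is
   [e ^ 2 * (om - c * (l * gam))]; the second makes it nonnegative at [x1]. *)
pose c := Num.min (om x1 / C) (psi x1).
have c0 : 0 < c by rewrite /c lt_min psi0 divr_gt0.
have cC : c * C <= om x1.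
  by rewrite -ler_pdivlMr// /c ge_min lexx.
exists c; split => //; exists x1 => x x1x.
have dD : has_deriv (fun x => (psi x - c) * e x) (fun x => e x ^+ 2 * (om x - c * (l x * gam x))).
  apply: has_deriv_eq (has_derivM (has_derivD dpsi (has_deriv_cst (- c))) de) _ _ => // y.
  transitivity (psi y * e y * (l y - h y) * (gam y * e y) - c * l y * e y * (gam y * e y)).
    by rewrite !ge; ring.
  by rewrite /om; ring.
have : (psi x1 - c) * e x1 <= (psi x - c) * e x.
  apply: (deriv_ge0_le (fun y _ => dD y)) x1x => y /andP[x1y _].
  rewrite mulr_ge0 ?sqr_ge0// subr_ge0 (le_trans _ (omx _ x1y))//.
  by apply: le_trans cC; exact: ler_wpM2l (ltW c0) _ _ (lgam y).
have : 0 <= (psi x1 - c) * e x1.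
  by apply: mulr_ge0; [rewrite subr_ge0 /c ge_min lexx orbT|exact: ltW].
move=> h1 h2; have := le_trans h1 h2.
by rewrite pmulr_lge0// subr_ge0.
Qed.

End Side.

(** At a point where the bound fails, the slope of [G] compared with [2 * h * kappa] decides on
    which side [growth_side] applies; the left side is reduced to the right one by reflection, which
    changes the signs of [h] and [G1]. In either case [psi] stays away from 0 near one end, against
    its square integrability. *)
Lemma riccati_lower_bound psi h G G1 G2 kappa : 0 < kappa ->
  has_deriv psi (fun x => - h x * psi x) -> has_deriv h (fun x => h x ^+ 2 - G x) ->
  has_deriv G G1 -> has_deriv G1 G2 -> (forall x, 2 * kappa ^+ 2 <= G2 x) ->
  (forall x, 0 < psi x) -> integrableR (fun x => psi x ^+ 2) ->
  forall x, kappa <= h x ^+ 2 - G x.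
Proof.
move=> k0 dpsi dh dG dG1 hG2 psi0 ipsi x0; rewrite leNgt; apply/negP => hx0.
have pp x : 0 <= psi x ^+ 2 by exact: sqr_ge0.
have [hx1|/ltW hx1] := leP (2 * h x0 * kappa) (G1 x0).
  have [c [c0 [N hN]]] := growth_side k0 dpsi dh dG dG1 hG2 psi0 hx0 hx1.
  apply: (@not_integrable_lower_bound _ (c ^+ 2) _ ipsi pp); first by rewrite exprn_gt0.
  move=> M M0; exists N => x /andP[Nx _].
  by rewrite !expr2; apply: ler_pM; rewrite ?hN// ltW.
have dN : has_deriv (fun x : R => - x) (fun=> -1).
  apply: has_deriv_eq (has_derivZ (-1) has_deriv_id) _ _ => x; rewrite ?mulr1//; exact: mulN1r.
have refl F f : has_deriv F f -> has_deriv (fun x => F (- x)) (fun x => - f (- x)).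
  move=> hF; apply: has_deriv_eq (has_deriv_comp hF dN) _ _ => // x.
  by rewrite mulrN1.
have [||||||||c [c0 [N hN]]] := @growth_side (fun x => psi (- x)) (fun x => - h (- x)) (fun x => G (- x))
    (fun x => - G1 (- x)) (fun x => G2 (- x)) kappa (- x0) k0.
- by apply: has_deriv_eq (refl _ _ dpsi) _ _ => // x; ring.
- apply: has_deriv_eq (has_derivZ (-1) (refl _ _ dh)) _ _ => x; ring.
- exact: refl.
- by apply: has_deriv_eq (has_derivZ (-1) (refl _ _ dG1)) _ _ => x; ring.
- by move=> x.
- by move=> x.
- by rewrite opprK sqrrN.
- by rewrite opprK; lra.
apply: (@not_integrable_lower_bound _ (c ^+ 2) _ ipsi pp); first by rewrite exprn_gt0.
move=> M M0; exists (- N - M) => x /andP[_ Nx].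
have := hN (- x); rewrite opprK => hh.
have {}hh : c <= psi x by apply: hh; lra.
by rewrite !expr2; apply: ler_pM => //; exact: ltW.
Qed.

End LogConcave.

(** * The derivative of the first eigenfunction has no zero *)

Section Nodes.
Variable R : realType.
Variable V : R -> R.
Hypothesis sV : smooth V.
Hypothesis iwt : integrableR (wt V).
Implicit Types (f g h F P u v : R -> R).

Let cV : continuous V. Proof. exact: smooth_cont. Qed.
Let cwt : continuous (wt V). Proof. exact: continuous_wt. Qed.
Let Zc0 : Zc V != 0. Proof. by rewrite gt_eqF// Zc_gt0. Qed.
Let wt0 x : wt V x != 0. Proof. by rewrite gt_eqF// wt_gt0. Qed.

Lemma dct_intR (u : nat -> R -> R) v g :
  (forall k, measurable_fun setT (u k)) -> (forall x, (fun k => u k x) @ \oo --> v x) ->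
  (forall k x, `|u k x| <= g x) -> integrableR g ->
  (fun k => intR (u k)) @ \oo --> intR v.
Proof.
move=> mu uv ug ig.
have mv : measurable_fun setT v by apply: (@measurable_fun_cvg _ _ R setT u v).
have [||||| iv _ H] := @dominated_convergence _ _ R (@lebesgue_measure R) setT measurableT
  (fun k x => (u k x)%:E) (fun x => (v x)%:E) (fun x => (g x)%:E).
- by move=> k; apply/measurable_EFinP; exact: mu.
- exact/measurable_EFinP.
- by apply/aeW => x _; apply: cvg_EFin; [exact: nearW|exact: uv].
- exact: ig.
- by apply/aeW => x k _; rewrite /= lee_fin.
rewrite /intR /Rintegral; apply: fine_cvg; rewrite fineK//.
exact: (integrable_fin_num measurableT iv).
Qed.

Lemma measurable_side (a sg : R) :
  measurable_fun setT (fun x : R => ((0 < sg * (x - a))%R)%:R : R).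
Proof.
have caff : continuous (fun x : R => sg * (x - a)).
  apply: contZ; apply: contD; first exact: (has_deriv_cont has_deriv_id).
  by move=> x; exact: cvg_cst.
rewrite (_ : (fun x => _) = \1_[set x | 0 < sg * (x - a)]).
  apply: measurable_indic; apply: open_measurable.
  by apply: (@open_comp R R _ [set z | 0 < z]) => [z _|]; [exact: caff|exact: open_gt].
apply/funext => x; rewrite indicE; case: (boolP (0 < sg * (x - a))) => h.
  by rewrite mem_set.
by rewrite memNset//; exact/negP.
Qed.

(* Two disjointly supported test functions span a plane, which meets every hyperplane. *)
Lemma lam1_le u v (rho : R) : Cc_inf u -> Cc_inf v ->
  (forall x, u x * v x = 0) -> (forall x, derive1 u x * derive1 v x = 0) ->
  0 < nrm2 V u -> 0 < nrm2 V v ->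
  nrm2 V (derive1 u) <= rho * nrm2 V u -> nrm2 V (derive1 v) <= rho * nrm2 V v ->
  (lam V 1 <= rho%:E)%E.
Proof.
move=> hu hv uv uv' u0 v0 ru rv.
have Lu := L2_Cc_inf sV hu; have Lv := L2_Cc_inf sV hv.
have Lu' := L2_Cc_inf sV (Cc_inf_deriv hu); have Lv' := L2_Cc_inf sV (Cc_inf_deriv hv).
apply: ge_ereal_sup => _ [gs [hgs ->]].
have Lg : L2 V (gs 0%N) by exact: hgs.
have [a [b [ab orth]]] : exists a b : R, 0 < a ^+ 2 + b ^+ 2 /\
    a * ip V u (gs 0%N) + b * ip V v (gs 0%N) = 0.
  have [e|e] := eqVneq (ip V u (gs 0%N)) 0.
    exists 1, 0; split; last by rewrite e mulr0 mul0r addr0.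
    by rewrite expr1n expr0n/= addr0.
  exists (- ip V v (gs 0%N)), (ip V u (gs 0%N)); split; last by ring.
  by rewrite ltr_wpDl ?sqr_ge0// exprn_even_gt0.
pose w x := a * u x + b * v x.
have sw : smooth w.
  exact: (smoothD (smoothM (smooth_cst a) hu.1) (smoothM (smooth_cst b) hv.1)).
have dw : has_deriv w (fun x => a * derive1 u x + b * derive1 v x).
  exact: has_derivD (has_derivZ a (smooth_deriv hu.1)) (has_derivZ b (smooth_deriv hv.1)).
have hw : Cc_inf w.
  split => //; have [_ cw] := ccD (ccZ a (Cc_inf_cc hu)) (ccZ b (Cc_inf_cc hv)).
  exact: cw.
have pyth f g : L2 V f -> L2 V g -> (forall x, f x * g x = 0) ->
    nrm2 V (fun x => a * f x + b * g x) = a ^+ 2 * nrm2 V f + b ^+ 2 * nrm2 V g.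
  move=> Lf Lh fg; have z : ip V f g = 0.
    rewrite ipE (@intR_ext _ _ (fun=> 0)); last by move=> x; rewrite fg mul0r.
    by rewrite /intR Rintegral_cst//= !mul0r.
  have Laf : L2 V (fun x => a * f x) by exact: L2Z.
  have Lbg : L2 V (fun x => b * g x) by exact: L2Z.
  have LD := L2D cV Laf Lbg.
  rewrite /nrm2 (ipDl cV Laf Lbg LD) !(ipDr cV Laf Lbg)// !(ipZl cV)// !(ipZr cV)// (ipC V g f) z.
  by ring.
have nw := pyth _ _ Lu Lv uv; rewrite -/w in nw.
have nw' : nrm2 V (derive1 w) = a ^+ 2 * nrm2 V (derive1 u) + b ^+ 2 * nrm2 V (derive1 v).
  by rewrite (has_deriv_derive1 dw) pyth.
have w0 : 0 < nrm2 V w.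
  rewrite nw; have [e|e] := eqVneq a 0.
    by move: ab; rewrite e expr0n/= !add0r mul0r add0r => b2; rewrite mulr_gt0.
  apply: ltr_wpDr; first by apply: mulr_ge0; [exact: sqr_ge0|exact: nrm2_ge0].
  by apply: mulr_gt0 => //; rewrite exprn_even_gt0.
apply: (@le_trans _ _ (- ip V w (Lop V w) / nrm2 V w)%:E).
  apply: ereal_inf_lbound; exists w, (Lop V w); split; first exact: closL_Cc_inf.
  split; first by rewrite gt_eqF.
  split => // i; rewrite ltnS leqn0 => /eqP ->.
  by rewrite /w (ipDl cV (L2Z cV a Lu) (L2Z cV b Lv) Lg) !(ipZl cV).
rewrite lee_fin ler_pdivrMr// ip_Lop// opprK nw' nw mulrDr.
rewrite (mulrCA rho) (mulrCA rho (b ^+ 2)).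
by apply: lerD; apply: ler_wpM2l => //; exact: sqr_ge0.
Qed.

(** Any nonzero test function yields a step: its square, rescaled to be supported in [[0, 1]], is
    integrated and divided by the total mass, which is positive because of [x0]. *)
Lemma smooth_step (phi : R -> R) x0 : Cc_inf phi -> phi x0 != 0 ->
  exists s : R -> R, [/\ smooth s, (forall x, x <= 0 -> s x = 0), (forall x, 1 <= x -> s x = 1),
    (forall x, 0 <= s x <= 1) & (forall x, x <= 0 \/ 1 <= x -> derive1 s x = 0)].
Proof.
move=> hphi px0.
have [a [b [ab [h _]]]] := cc_restrict (Cc_inf_cc hphi).
pose A := a - 1; pose B := b + 1; pose d := B - A.
have d0 : 0 < d by rewrite /d /A /B; lra.
pose q x := phi (d * x + A).
have sq : smooth q by exact: (smooth_affine phi d A hphi.1).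
pose bb x := q x * q x.
have sb : smooth bb by exact: smoothM.
have bb0 x : 0 <= bb x by rewrite /bb -expr2 sqr_ge0.
have bz x : x <= 0 \/ 1 <= x -> bb x = 0.
  move=> hx; rewrite /bb /q h ?mul0r//; case: hx => hx; [left|right].
    by rewrite /A in d0 *; nra.
  by have : d * 1 <= d * x; [rewrite ler_wpM2l// ltW|rewrite /d /B /A; lra].
have cb := smooth_cont sb.
have [S hS] := primitive_exists cb.
have ccb : cc bb by split => //; exists 0, 1 => x hx; apply: bz; case: hx => /ltW; [left|right].
have m0 : 0 < S 1 - S 0.
  rewrite -(ftc_cc ler01 hS cb); last by move=> x hx; apply: bz; case: hx => /ltW; [left|right].
  apply: (@intR_gt0 _ _ ((x0 - A) / d)) => //; first exact: integrable_cc.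
  rewrite /bb /q (_ : d * _ + A = x0); last by field; rewrite gt_eqF.
  by rewrite -expr2 exprn_even_gt0.
pose m := S 1 - S 0.
pose s x := m^-1 * (S x - S 0).
have ds : has_deriv s (fun x => m^-1 * bb x).
  apply: has_deriv_eq (has_derivZ m^-1 (has_derivD hS (has_deriv_cst (- S 0)))) _ _ => // x.
  by rewrite addr0.
have mono x y : x <= y -> s x <= s y.
  apply: (deriv_ge0_le (fun x _ => ds x)) => t _.
  by rewrite mulr_ge0// invr_ge0 ltW.
have s0 x : x <= 0 -> s x = 0.
  move=> x0'; rewrite (_ : s x = s 0); first by rewrite /s subrr mulr0.
  apply: deriv0_cst x0' => t /andP[_ t0].
  by have := ds t; rewrite bz ?mulr0//; left.
have s1 x : 1 <= x -> s x = 1.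
  move=> x1; rewrite -(_ : s 1 = s x); first by rewrite /s mulVf// gt_eqF.
  apply: deriv0_cst x1 => t /andP[t0 _].
  by have := ds t; rewrite bz ?mulr0//; right.
exists s; split; [|exact: s0|exact: s1| |].
- apply: (smooth_primitive ds); exact: (smoothM (smooth_cst m^-1) sb).
- move=> x; have [x0'|/ltW x0'] := leP x 0; first by rewrite s0// lexx ler01.
  have [x1|/ltW x1] := leP 1 x; first by rewrite s1// lexx ler01.
  by rewrite -(s0 0)// -(s1 1)// !mono.
- by move=> x hx; rewrite (has_deriv_derive1 ds) bz// mulr0.
Qed.

(** Gronwall in both directions: [m = F ^ 2 + P ^ 2] satisfies [|m'| <= C * m], so with a primitive
    [S] of [C] the product of [m] with [expR (- S)] is nonincreasing and that with [expR S]
    nondecreasing. Both vanish at [a]. *)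
Lemma ode_unique F P r a : has_deriv F (fun x => P x / wt V x) ->
  has_deriv P (fun x => - r * (F x * wt V x)) -> F a = 0 -> P a = 0 -> forall x, F x = 0.
Proof.
move=> hF hP Fa Pa.
pose C x := (wt V x)^-1 + `|r| * wt V x.
have cC : continuous C.
  by apply: contD; [exact: continuous_invwt|apply: contZ].
have [S hS] := primitive_exists cC.
pose m x := F x ^+ 2 + P x ^+ 2.
pose m1 x := 2 * F x * (P x / wt V x) + 2 * P x * (- r * (F x * wt V x)).
have dm : has_deriv m m1 by exact: has_derivD (has_derivX2 hF) (has_derivX2 hP).
have w0 x : 0 < wt V x := wt_gt0 V x.
have bnd x : `|m1 x| <= C x * m x.
  rewrite (_ : m1 x = 2 * F x * P x * ((wt V x)^-1 - r * wt V x)); last by rewrite /m1; ring.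
  rewrite normrM mulrC ler_pM//.
    have i0 : 0 <= (wt V x)^-1 by rewrite invr_ge0 ltW.
    by apply: (le_trans (ler_normB _ _)); rewrite normrM (ger0_norm (ltW (w0 x))) (ger0_norm i0).
  rewrite ler_norml /m; have := sqr_ge0 (F x + P x); have := sqr_ge0 (F x - P x).
  by move=> ? ?; apply/andP; split; nra.
have m0 x : 0 <= m x by rewrite addr_ge0 ?sqr_ge0.
have ma : m a = 0 by rewrite /m Fa Pa expr0n addr0.
have de1 := has_derivM dm (has_deriv_expR (has_derivZ (-1) hS)).
have de2 := has_derivM dm (has_deriv_expR hS).
have mz x : m x = 0.
  apply/eqP; rewrite eq_le m0 andbT.
  have [ax|/ltW xa] := leP a x.
    have : - (m a * expR (-1 * S a)) <= - (m x * expR (-1 * S x)).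
      apply: (deriv_ge0_le (fun t _ => is_deriveN (de1 t))) ax => t _.
      rewrite (_ : - _ = (C t * m t - m1 t) * expR (-1 * S t)); last by ring.
      by rewrite mulr_ge0 ?expR_ge0// subr_ge0 (le_trans _ (bnd t))// ler_norm.
    by rewrite ma mul0r oppr0 oppr_ge0 pmulr_lle0// expR_gt0.
  have : m x * expR (S x) <= m a * expR (S a).
    apply: (deriv_ge0_le (fun t _ => de2 t)) xa => t _.
    rewrite (_ : _ + _ = (C t * m t + m1 t) * expR (S t)); last by ring.
    rewrite mulr_ge0 ?expR_ge0//; have := bnd t; rewrite ler_norml => /andP[? _]; lra.
  by rewrite ma mul0r pmulr_lle0// expR_gt0.
move=> x; apply/eqP; rewrite -sqrf_eq0; apply/eqP.
by have := mz x; rewrite /m; have := sqr_ge0 (F x); have := sqr_ge0 (P x); lra.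
Qed.

End Nodes.

(** * Cutting the eigenfunction off at a critical point *)

Section NodeTest.
Variable R : realType.
Variable V : R -> R.
Hypothesis sV : smooth V.
Hypothesis iwt : integrableR (wt V).
Variables (F P : R -> R) (r a sg : R).
Hypothesis hF : has_deriv F (fun x => P x / wt V x).
Hypothesis hP : has_deriv P (fun x => - r * (F x * wt V x)).
Hypothesis LF : L2 V F.
Hypothesis r0 : 0 < r.
Hypothesis Fa : F a != 0.
(* [sg] is 1 or -1 and selects the half-line to the right or to the left of [a] *)
Hypothesis sg1 : sg ^+ 2 = 1.
Let side (x : R) : R := ((0 < sg * (x - a))%R)%:R.
Hypothesis Fside : intR (fun x => F x * wt V x * side x) = 0.
Variable s : R -> R.
Hypothesis ss : smooth s.
Hypothesis s0 : forall x, x <= 0 -> s x = 0.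
Hypothesis s1 : forall x, 1 <= x -> s x = 1.
Hypothesis s01 : forall x, 0 <= s x <= 1.
Hypothesis ds0 : forall x, x <= 0 \/ 1 <= x -> derive1 s x = 0.

Let cV : continuous V. Proof. exact: smooth_cont. Qed.
Let cwt : continuous (wt V). Proof. exact: continuous_wt. Qed.
Let Zc0 : Zc V != 0. Proof. by rewrite gt_eqF// Zc_gt0. Qed.
Let wt0 x : wt V x != 0. Proof. by rewrite gt_eqF// wt_gt0. Qed.

(** Bootstrap: by the first-order system, [F] and [P] are each one level smoother than the other. *)
Lemma ode_smooth : smooth F.
Proof.
have sw : smooth (wt V).
  have h := smooth_expR (smoothM (smooth_cst (-1)) sV).
  by rewrite (_ : wt V = fun x => expR (-1 * V x))//; apply/funext => x; rewrite mulN1r.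
have siw : smooth (fun x => (wt V x)^-1).
  rewrite (_ : (fun x => _) = fun x => expR (V x)); first exact: smooth_expR sV.
  by apply/funext => x; rewrite /wt -expRN opprK.
have hFP n : Ck n F /\ Ck n P.
  elim: n => [|n [IF IP]]; first by split; [exact: (Ck_0 hF)|exact: (Ck_0 hP)].
  move/smoothP: sw => sw; move/smoothP: siw => siw; split.
    exact: (Ck_deriv hF (CkM IP (siw n))).
  exact: (Ck_deriv hP (CkM (@Ck_cst R n (- r)) (CkM IF (sw n)))).
by apply/smoothP => n; have [] := hFP n.
Qed.

Let y x := sg * (x - a).
Let n_ (k : nat) : R := k.+1%:R.
(* [th k] vanishes for [y <= 0] and for [y >= 2 n], and is 1 for [1 / n <= y <= n]. *)
Let th1 k x := s (n_ k * y x).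
Let th2 k x := s (2 - y x / n_ k).
Let th k x := th1 k x * th2 k x.
Let thd k x := derive1 s (n_ k * y x) * (n_ k * sg) * th2 k x
  + th1 k x * (derive1 s (2 - y x / n_ k) * (- (sg / n_ k))).

Let n0 k : 0 < n_ k. Proof. by rewrite /n_ ltr0n. Qed.

Let th_smooth k : smooth (th k).
Proof.
have e1 : th1 k = fun x => s (n_ k * sg * x + - (n_ k * sg * a)).
  by apply/funext => x; rewrite /th1 /y; congr s; ring.
have e2 : th2 k = fun x => s (- (sg / n_ k) * x + (2 + sg * a / n_ k)).
  by apply/funext => x; rewrite /th2 /y; congr s; field; rewrite gt_eqF.
by rewrite /th e1 e2; exact: (smoothM (smooth_affine s _ _ ss) (smooth_affine s _ _ ss)).
Qed.

Let dy : has_deriv y (fun=> sg).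
Proof.
apply: has_deriv_eq (has_derivZ sg (has_derivD has_deriv_id (has_deriv_cst (- a)))) _ _ => // x.
by rewrite addr0 mulr1.
Qed.

Let th_deriv k : has_deriv (th k) (thd k).
Proof.
have dsd := smooth_deriv ss.
have d1 : has_deriv (th1 k) (fun x => derive1 s (n_ k * y x) * (n_ k * sg)).
  exact: has_deriv_comp dsd (has_derivZ (n_ k) dy).
have d2 : has_deriv (th2 k) (fun x => derive1 s (2 - y x / n_ k) * (- (sg / n_ k))).
  apply: has_deriv_comp dsd _.
  apply: has_deriv_eq (has_derivD (has_deriv_cst 2) (has_derivZ (- (n_ k)^-1) dy)) _ _ => x; ring.
exact: has_derivM d1 d2.
Qed.

Let th_neg k x : y x <= 0 -> th k x = 0 /\ thd k x = 0.
Proof.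
move=> yx; have nyx : n_ k * y x <= 0 by rewrite pmulr_rle0.
by rewrite /th /thd /th1 (s0 nyx) ds0 ?mul0r ?addr0//; left.
Qed.

Let th_supp k : compact_supp (th k).
Proof.
exists (a - 2 * n_ k), (a + 2 * n_ k) => x hx; rewrite /th.
have [yx|yx] := leP (y x) 0; first by have [] := th_neg k yx.
rewrite (_ : th2 k x = 0) ?mulr0//; apply: s0.
rewrite subr_le0 ler_pdivlMr//.
have sgE : sg = 1 \/ sg = -1.
  have : (sg - 1) * (sg + 1) = 0 by rewrite -subr_sqr expr1n sg1 subrr.
  move/eqP; rewrite mulf_eq0 => /orP[] /eqP ?; [left|right]; lra.
by have := n0 k; move: yx; rewrite /y; case: sgE => ->; case: hx => ?; lra.
Qed.

Let cth k : continuous (th k). Proof. exact: smooth_cont (@th_smooth k). Qed.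
Let cthd k : continuous (thd k).
Proof.
have h := smooth_cont (smooth_derive1 (@th_smooth k)).
by rewrite -(has_deriv_derive1 (th_deriv k)).
Qed.

Let th01 k x : 0 <= th k x <= 1.
Proof.
have /andP[a0 a1] := s01 (n_ k * y x); have /andP[b0 b1] := s01 (2 - y x / n_ k).
by rewrite /th mulr_ge0//= mulr_ile1.
Qed.

Let f0 x := F x - F a.
Let u k x := f0 x * th k x.
Let u' k x := P x / wt V x * th k x + f0 x * thd k x.

Let cF : continuous F. Proof. exact: has_deriv_cont hF. Qed.
Let cP : continuous P. Proof. exact: has_deriv_cont hP. Qed.
Let df0 : has_deriv f0 (fun x => P x / wt V x).
Proof.
apply: has_deriv_eq (has_derivD hF (has_deriv_cst (- F a))) _ _ => // x.
by rewrite addr0.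
Qed.
Let cf0 : continuous f0. Proof. exact: has_deriv_cont df0. Qed.
Let Lf0 : L2 V f0.
Proof. by apply: L2B => //; exact: L2_cst. Qed.

Let du k : has_deriv (u k) (u' k).
Proof. exact: has_derivM df0 (th_deriv k). Qed.

Let hu k : Cc_inf (u k).
Proof.
split.
  have sf0 : smooth f0 by exact: (smoothB ode_smooth (smooth_cst (F a))).
  exact: (smoothM sf0 (@th_smooth k)).
have [A [B h]] := th_supp k; exists A, B => x hx.
by rewrite /u h// mulr0.
Qed.

Let ccth k : cc (th k). Proof. by split; [exact: cth|exact: th_supp]. Qed.
Let ccthd k : cc (thd k).
Proof. exact: cc_deriv (th_deriv k) (cthd (k := k)) (th_supp k). Qed.

(* After the ground state substitution only the derivative of the cutoff survives. *)
Let energy k : intR (fun x => u' k x ^+ 2 * wt V x) - r * intR (fun x => u k x ^+ 2 * wt V x) =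
  r * F a * intR (fun x => f0 x * th k x ^+ 2 * wt V x) + intR (fun x => f0 x ^+ 2 * thd k x ^+ 2 * wt V x).
Proof.
have ciw : continuous (fun x => P x / wt V x) by exact: contM cP (continuous_invwt sV).
have ccu' : cc (u' k).
  by apply: ccD; [exact: ccM ciw (ccth k)|exact: ccM cf0 (ccthd k)].
have i1 : cc (fun x => u' k x ^+ 2 * wt V x) by exact: ccMr (ccX2 ccu') cwt.
have i2 : cc (fun x => u k x ^+ 2 * wt V x) by exact: ccMr (ccX2 (ccM cf0 (ccth k))) cwt.
have i3 : cc (fun x => f0 x * th k x ^+ 2 * wt V x) by exact: ccMr (ccM cf0 (ccX2 (ccth k))) cwt.
have i4 : cc (fun x => f0 x ^+ 2 * thd k x ^+ 2 * wt V x).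
  by exact: ccMr (ccM (contX2 cf0) (ccX2 (ccthd k))) cwt.
have j1 := integrable_cc i1; have j2 := integrable_cc i2.
have j3 := integrable_cc i3; have j4 := integrable_cc i4.
rewrite -!intRZ// -intRB//; last exact: integrableRZ.
rewrite -intRD//; last exact: integrableRZ.
apply/eqP; rewrite -subr_eq0 -intRB; last 2 first.
- by apply: integrableRB => //; exact: integrableRZ.
- by apply: integrableRD => //; exact: integrableRZ.
(* The derivative of this product contains the cross term of [u' ^ 2 * wt]; in the term coming from
   [hP], splitting [F] as [f0 + F a] produces [r * u ^ 2] and the integral with the factor [F a]. *)
apply/eqP; apply: (@intR_deriv0 _ (fun x => (f0 x * P x) * th k x ^+ 2)).
- apply: has_deriv_eq (has_derivM (has_derivM df0 hP) (has_derivX2 (th_deriv k))) _ _ => // x.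
  have w0 := wt0 x; rewrite /u' /u /f0; field.
  exact: w0.
- by apply: ccB; [apply: ccB => //; exact: ccZ|apply: ccD => //; exact: ccZ].
- have [A [B h]] := th_supp k; exists A, B => x hx.
  by rewrite h// expr0n mulr0.
Qed.

Let n_large (e : R) : 0 < e -> \forall k \near \oo, 1 <= n_ k * e.
Proof.
move=> e0; have : \forall k \near \oo, (k%:R : R) >= e^-1 by exact: nbhs_infty_ger.
apply: filterS => k hk; rewrite -ler_pdivrMr// mul1r (le_trans hk)//.
by rewrite /n_ ler_nat.
Qed.

Let th_cvg x : (fun k => th k x) @ \oo --> side x.
Proof.
have [yx|yx] := leP (y x) 0.
  rewrite (_ : side x = 0); last by rewrite /side ltNge -/(y x) yx.
  rewrite (_ : (fun k => th k x) = fun=> 0); first exact: cvg_cst.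
  by apply/funext => k; have [] := th_neg k yx.
rewrite (_ : side x = 1); last by rewrite /side -/(y x) yx.
apply: cvg_near_cst; near=> k.
have h1 : 1 <= n_ k * y x by near: k; exact: n_large.
have h2 : 1 <= n_ k * (y x)^-1 by near: k; apply: n_large; rewrite invr_gt0.
rewrite /th /th1 /th2 (s1 h1) mul1r; apply: s1.
have : y x / n_ k <= 1 by rewrite ler_pdivrMr// mul1r; move: h2; rewrite ler_pdivlMr ?mul1r.
by move=> h; rewrite (_ : 2 - y x / n_ k = 1 + (1 - y x / n_ k)); [rewrite lerDl subr_ge0|ring].
Unshelve. all: end_near.
Qed.

Let cut1 : (fun k => intR (fun x => f0 x * th k x ^+ 2 * wt V x)) @ \oo -->
  intR (fun x => f0 x * side x ^+ 2 * wt V x).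
Proof.
apply: (@dct_intR _ _ _ (fun x => `|f0 x * 1 * wt V x|)).
- move=> k; apply: measurable_cont; apply: contM cwt.
  by apply: contM cf0 _; exact: contX2.
- move=> x; apply: cvgM; last exact: cvg_cst.
  apply: cvgM; first exact: cvg_cst.
  by rewrite expr2; under eq_fun do rewrite expr2; apply: cvgM; exact: th_cvg.
- move=> k x; have /andP[t0 t1] := th01 k x.
  rewrite (normrM (f0 x * th k x ^+ 2)) (normrM (f0 x * 1)) mulr1; apply: ler_wpM2r => //.
  rewrite (normrM (f0 x)); apply: ler_piMr => //.
  by rewrite normrX (ger0_norm t0) exprn_ile1.
- by apply: integrableR_norm; apply: L2_mul => //; exact: L2_cst.
Qed.

(** The slope of the cutoff is of order [n] on the strip [0 < y < 1 / n], but [f0] vanishes at [a]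
    and is Lipschitz nearby, so [f0 * thd] stays bounded there. The outer cutoff has slope of order
    [1 / n]. Pointwise the product tends to 0, and dominated convergence applies. *)
Let cut2 : (fun k => intR (fun x => f0 x ^+ 2 * thd k x ^+ 2 * wt V x)) @ \oo --> (0 : R).
Proof.
have z : intR (fun _ : R => 0) = 0 by rewrite /intR Rintegral_cst//= mul0r.
rewrite -z.
have ccs : cc (derive1 s).
  split; first exact: smooth_cont (smooth_derive1 ss).
  by exists 0, 1 => x hx; apply: ds0; case: hx => /ltW; [left|right].
have [M [M0 hM]] := cc_bounded ccs.
have [D [D0 hD]] := segment_bounded (a - 1) (a + 1) (contM cP (continuous_invwt sV)).
have hf0 x : `|x - a| <= 1 -> `|f0 x| <= D * `|x - a|.
  rewrite ler_norml => /andP[x1 x2].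
  have [ax|/ltW xa] := leP a x.
    have [c [/andP[c1 c2] e]] := mvt (fun t _ => hF t) ax.
    by rewrite /f0 e normrM ler_wpM2r// hD//; apply/andP; split; lra.
  have [c [/andP[c1 c2] e]] := mvt (fun t _ => hF t) xa.
  rewrite /f0 distrC e normrM (distrC a) ler_wpM2r// hD//; apply/andP; split; lra.
have nsg : `|sg| = 1.
  by apply/eqP; rewrite -(@eqrXn2 _ 2%N) ?normr_ge0// -normrX sg1 normr1 expr1n.
have ny x : `|y x| = `|x - a| by rewrite /y normrM nsg mul1r.
have thb k x : `|thd k x| <= n_ k * `|derive1 s (n_ k * y x)| + M / n_ k.
  have /andP[a0 a1] := s01 (n_ k * y x); have /andP[b0 b1] := s01 (2 - y x / n_ k).
  apply: (le_trans (ler_normD _ _)); apply: lerD.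
    rewrite !normrM nsg mulr1 (ger0_norm (ltW (n0 k))) (mulrC `|derive1 s _|).
    by apply: ler_piMr; [exact: mulr_ge0 (ltW (n0 k)) (normr_ge0 _)|rewrite ger0_norm].
  have e : `|- (sg / n_ k)| = (n_ k)^-1.
    by rewrite normrN normrM nsg mul1r ger0_norm// invr_ge0 ltW.
  have i0 : 0 <= (n_ k)^-1 by rewrite invr_ge0 ltW.
  rewrite !normrM e; apply: (@le_trans _ _ (`|derive1 s (2 - y x / n_ k)| * (n_ k)^-1)).
    by apply: ler_piMl; [exact: mulr_ge0|rewrite ger0_norm].
  by rewrite ler_wpM2r.
(* The inner slope contributes at most [M * D] and the outer one at most [M * |f0|]; the majorant
   bounds the square of their sum. *)
apply: (@dct_intR _ _ _ (fun x => 2 * M ^+ 2 * D ^+ 2 * wt V x + 2 * M ^+ 2 * (f0 x ^+ 2 * wt V x))).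
- move=> k; apply: measurable_cont; apply: contM cwt.
  by apply: contM; apply: contX2 => //; exact: cthd.
- move=> x; rewrite -(mul0r (wt V x)); apply: cvgM; last exact: cvg_cst.
  have [xa|xa] := eqVneq x a.
    rewrite (_ : (fun k => _) = fun=> 0); first exact: cvg_cst.
    by apply/funext => k; rewrite /f0 xa subrr expr0n mul0r.
  rewrite -(mulr0 (f0 x ^+ 2)); apply: cvgM; first exact: cvg_cst.
  have yx0 : 0 < `|y x| by rewrite ny normr_gt0 subr_eq0.
  apply: (@squeeze_cvgr _ _ _ _ (fun=> 0) (fun k => (n_ k)^-1 * M ^+ 2)).
  + near=> k; rewrite sqr_ge0/=.
    have h1 : 1 <= n_ k * `|y x| by near: k; exact: n_large.
    have n1 : 1 <= n_ k by rewrite /n_ ler1n.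
    have dz : derive1 s (n_ k * y x) = 0.
      apply: ds0; have [y0|y0] := leP (y x) 0; [left|right].
        by rewrite pmulr_rle0.
      by move: h1; rewrite gtr0_norm.
    have := thb k x; rewrite dz normr0 mulr0 add0r => h.
    rewrite -(real_normK (num_real (thd k x))).
    apply: (@le_trans _ _ ((M / n_ k) ^+ 2)).
      by rewrite !expr2; apply: ler_pM.
    have i0 : 0 <= (n_ k)^-1 by rewrite invr_ge0 ltW.
    rewrite exprMn mulrC ler_wpM2r ?sqr_ge0// expr2; apply: ler_piMl => //.
    by rewrite invf_le1.
  + exact: cvg_cst.
  + by apply: cvg0Mr; exact: cvg_harmonic.
- move=> k x; have p0 := mulr_ge0 (sqr_ge0 (f0 x)) (sqr_ge0 (thd k x)).
  rewrite ger0_norm; last exact: mulr_ge0 p0 (wt_ge0 V x).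
  rewrite (mulrA (2 * M ^+ 2) (f0 x ^+ 2)) -mulrDl; apply: ler_wpM2r; first exact: wt_ge0.
  have n1 : 1 <= n_ k by rewrite /n_ ler1n.
  have h := thb k x.
  have key : `|f0 x| * (n_ k * `|derive1 s (n_ k * y x)|) <= M * D.
    have [yn|yn] := leP `|y x| (n_ k)^-1; last first.
      have H1 : 1 < n_ k * `|y x| by rewrite mulrC -ltr_pdivrMr// mul1r.
      rewrite ds0 ?normr0 ?mulr0 ?mulr_ge0//.
      have [y0|y0] := leP (y x) 0; [by left; rewrite pmulr_rle0|right; apply: ltW].
      by move: H1; rewrite gtr0_norm.
    have xa : `|x - a| <= 1 by rewrite -ny (le_trans yn)// invf_le1.
    rewrite mulrA mulrC; apply: ler_pM => //; first by rewrite mulr_ge0// ltW.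
    apply: (@le_trans _ _ (D * `|x - a| * n_ k)).
      by apply: ler_wpM2r; [exact: ltW|exact: hf0].
    rewrite -mulrA; apply: ler_piMr => //; rewrite -ny.
    by move: yn; rewrite -ler_pdivlMr// div1r.
  have h2 : `|f0 x| * `|thd k x| <= M * D + M * `|f0 x|.
    apply: (le_trans (ler_wpM2l (normr_ge0 (f0 x)) h)).
    rewrite mulrDr; apply: lerD => //.
    rewrite mulrC; apply: ler_wpM2r => //; apply: ler_piMr => //.
    by rewrite invf_le1.
  rewrite -exprMn -(real_normK (num_real (f0 x * thd k x))) normrM.
  apply: (@le_trans _ _ ((M * D + M * `|f0 x|) ^+ 2)).
    by rewrite !expr2; apply: ler_pM => //; rewrite mulr_ge0.
  rewrite -(real_normK (num_real (f0 x))).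
  by have := sqr_ge0 (M * D - M * `|f0 x|); nra.
- apply: integrableRD; first exact: integrableRZ.
  by apply: integrableRZ; exact: L2_int.
Unshelve. all: end_near.
Qed.

(** On the chosen side [F] has integral 0, so [f0 = F - F a] has integral [- F a * m]. In the limit
    the right side of [energy] is therefore [- r * F a ^ 2 * m < 0], and a late cutoff already has
    Rayleigh quotient below [r]. *)
Lemma node_test : 0 < intR (fun x => wt V x * side x) -> exists v, [/\ Cc_inf v,
  (forall x, sg * (x - a) <= 0 -> v x = 0 /\ derive1 v x = 0) &
  nrm2 V (derive1 v) < r * nrm2 V v].
Proof.
move=> m0; set m := intR _ in m0.
have side2 x : side x ^+ 2 = side x by rewrite /side; case: (_ < _); rewrite ?expr1n ?expr0n.
have mside : measurable_fun setT side by exact: measurable_side.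
have Lside : L2 V side.
  apply: (@L2_bounded _ _ cV iwt _ 1) => // x.
  by rewrite /side; case: (_ < _); rewrite ?normr1 ?normr0.
have lim : intR (fun x => f0 x * side x ^+ 2 * wt V x) = - F a * m.
  have L1 : L2 V (fun=> 1) by exact: L2_cst.
  have i1 : integrableR (fun x => F x * wt V x * side x).
    by apply: integrableR_ext (L2_mul cV LF Lside) => x; ring.
  have i2 : integrableR (fun x => wt V x * side x).
    by apply: integrableR_ext (L2_mul cV L1 Lside) => x; ring.
  rewrite -[LHS]addr0 -[X in _ + X]oppr0 -Fside /m -intRZ//.
  apply/eqP; rewrite subr_eq addrC -intRD//; last exact: integrableRZ.
  apply/eqP; apply: intR_ext => x; rewrite side2 /f0; ring.
have cv : (fun k => r * F a * intR (fun x => f0 x * th k x ^+ 2 * wt V x) +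
    intR (fun x => f0 x ^+ 2 * thd k x ^+ 2 * wt V x)) @ \oo --> r * F a * (- F a * m) + 0.
  apply: cvgD; last exact: cut2.
  by apply: cvgM; [exact: cvg_cst|rewrite -lim; exact: cut1].
have neg : r * F a * (- F a * m) + 0 < 0.
  have -> : r * F a * (- F a * m) + 0 = - (r * F a ^+ 2 * m) by ring.
  by rewrite oppr_lt0 mulr_gt0// mulr_gt0// exprn_even_gt0.
have [k hk] : exists k, r * F a * intR (fun x => f0 x * th k x ^+ 2 * wt V x) +
    intR (fun x => f0 x ^+ 2 * thd k x ^+ 2 * wt V x) < 0.
  have : \forall k \near \oo, r * F a * intR (fun x => f0 x * th k x ^+ 2 * wt V x) +
    intR (fun x => f0 x ^+ 2 * thd k x ^+ 2 * wt V x) < 0 by exact: (cvgr_lt _ cv).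
  by move=> [N _ hN]; exists N; exact: hN (leqnn N).
exists (u k); split; first exact: hu.
  move=> x yx; have [t1 t2] := th_neg k yx.
  by rewrite (has_deriv_derive1 (du k)) /u /u' t1 t2 !mulr0 addr0.
rewrite (has_deriv_derive1 (du k)).
have := energy k; rewrite (nrm2_intR sV iwt (u' k)) (nrm2_intR sV iwt (u k)) => E.
have : (nrm2 V (u' k) - r * nrm2 V (u k)) * Zc V < 0.
  rewrite (_ : _ * Zc V = nrm2 V (u' k) * Zc V - r * (nrm2 V (u k) * Zc V)); last by ring.
  by rewrite E.
by rewrite pmulr_llt0 ?Zc_gt0// subr_lt0.
Qed.

End NodeTest.

(** * Constant sign of the derivative of the eigenfunction *)

Section Monotone.
Variable R : realType.
Variable V : R -> R.
Hypothesis sV : smooth V.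
Hypothesis iwt : integrableR (wt V).
Implicit Types (f g h F P u v : R -> R).

Let cV : continuous V. Proof. exact: smooth_cont. Qed.
Let cwt : continuous (wt V). Proof. exact: continuous_wt. Qed.
Let Zc0 : Zc V != 0. Proof. by rewrite gt_eqF// Zc_gt0. Qed.
Let wt0 x : wt V x != 0. Proof. by rewrite gt_eqF// wt_gt0. Qed.

Lemma wt_side_gt0 (a sg : R) : sg ^+ 2 = 1 ->
  0 < intR (fun x => wt V x * ((0 < sg * (x - a))%R)%:R).
Proof.
move=> sg1; pose b := a + sg.
have hb x : b - 1 / 2 <= x <= b + 1 / 2 -> 0 < sg * (x - a).
  move=> /andP[h1 h2]; have sgE : sg = 1 \/ sg = -1.
    have : (sg - 1) * (sg + 1) = 0 by rewrite -subr_sqr expr1n sg1 subrr.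
    by move/eqP; rewrite mulf_eq0 => /orP[] /eqP ?; [left|right]; lra.
  by move: h1 h2; rewrite /b; case: sgE => ->; lra.
have [G hG] := primitive_exists cwt.
have le : b - 1 / 2 <= b + 1 / 2 by lra.
have iw : integrableR (fun x => wt V x * ((0 < sg * (x - a))%R)%:R).
  apply: (@le_integrableR _ _ (wt V)) => //.
    apply: measurable_funM; first exact: measurable_wt.
    exact: measurable_side.
  move=> x; rewrite normrM (ger0_norm (wt_ge0 V x)); apply: ler_piMr; first exact: wt_ge0.
  by case: (_ < _); rewrite ?normr1 ?normr0.
apply: (@lt_le_trans _ _ (intR (wt V \_ `[b - 1 / 2, b + 1 / 2]))).
  rewrite (ftc_itv le hG cwt) subr_gt0.
  by apply: (deriv_gt0_lt (fun x _ => hG x)); [move=> x _; exact: wt_gt0|lra].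
apply: le_intR => //; first exact: integrable_itv.
move=> x; rewrite patchE; case: ifPn => [|_]; last first.
  by apply: mulr_ge0; [exact: wt_ge0|case: (_ < _)].
by rewrite mem_setE in_itv/= => /hb ->; rewrite mulr1.
Qed.

(** A zero of [P] at [a] means that [F] has integral 0 on each side of [a], while [F a != 0] by
    uniqueness for the system. Hence [node_test] applies on both sides, and its two disjointly
    supported functions push [lam V 1] below [r]. The data [phi], [x0] feed [smooth_step]. *)
Lemma eigen_no_node F P (r : R) (phi : R -> R) (x0 a : R) : has_deriv F (fun x => P x / wt V x) ->
  has_deriv P (fun x => - r * (F x * wt V x)) -> L2 V F -> 0 < r ->
  (lam V 1 = r%:E)%E -> Cc_inf phi -> phi x0 != 0 -> nrm2 V F != 0 ->
  intR (fun x => F x * wt V x) = 0 ->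
  (forall x, P x = - r * intR ((fun x => F x * wt V x) \_ `]-oo, x])) ->
  P a != 0.
Proof.
move=> hF hP LF r0 lr hphi px0 nF F1 PE; apply/negP => /eqP Pa.
have Fa : F a != 0.
  apply/negP => /eqP Fa; have F0 := ode_unique sV hF hP Fa Pa.
  by move/negP: nF; apply; rewrite (_ : F = fun=> 0) ?/nrm2 ?ip0l//; apply/funext.
have [s [ss s0 s1 s01 ds0]] := smooth_step hphi px0.
have iF : integrableR (fun x => F x * wt V x).
  by apply: integrableR_ext (L2_mul cV LF (L2_cst cV iwt 1)) => x; rewrite mulr1.
have Il : intR ((fun x => F x * wt V x) \_ `]-oo, a]) = 0.
  have := PE a; rewrite Pa => /esym/eqP; rewrite mulf_eq0 oppr_eq0 gt_eqF//= => /eqP.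
  by [].
have cFw : continuous (fun x => F x * wt V x) by apply: contM => //; exact: has_deriv_cont hF.
have iray : integrableR ((fun x => F x * wt V x) \_ `]-oo, a]).
  have L := L2_mul cV LF (L2_indic sV iwt `]-oo, a]).
  apply: integrableR_ext L => x; rewrite patchE indicE.
  by case: (_ \in _); rewrite ?mulr1// mulr0 mul0r.
have right : intR (fun x => F x * wt V x * ((0 < 1 * (x - a))%R)%:R) = 0.
  have e : intR (fun x => F x * wt V x * ((0 < 1 * (x - a))%R)%:R) =
      intR (fun x => F x * wt V x) - intR ((fun x => F x * wt V x) \_ `]-oo, a]).
    rewrite -intRB//; apply: intR_ext => x; rewrite patchE mem_setE in_itv/= mul1r subr_gt0.
    by case: (leP x a) => _; rewrite ?mulr1 ?mulr0 ?subrr ?subr0.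
  by rewrite e F1 Il subr0.
have left : intR (fun x => F x * wt V x * ((0 < -1 * (x - a))%R)%:R) = 0.
  have z : (fun x => F x * wt V x) \_ `]-oo, a] = (fun x => F x * wt V x * ((0 < -1 * (x - a))%R)%:R)
      \+ (fun x => F x * wt V x) \_ [set a].
    apply/funext => x; rewrite /= !patchE mem_setE in_itv/= mulN1r oppr_gt0 subr_lt0.
    case: (ltrgtP x a) => [xa|xa|->]; rewrite ?mulr1 ?mulr0.
    - by rewrite memNset ?addr0// => /= e; move: xa; rewrite e ltxx.
    - by rewrite memNset ?addr0// => /= e; move: xa; rewrite e ltxx.
    - by rewrite mem_set// add0r.
  have ip1 : integrableR ((fun x => F x * wt V x) \_ [set a]).
    rewrite -set_itv1; exact: integrable_itv.
  have I1 : intR ((fun x => F x * wt V x) \_ [set a]) = 0.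
    by rewrite /intR -Rintegral_mkcond Rintegral_set1.
  have e : (fun x => F x * wt V x * ((0 < -1 * (x - a))%R)%:R) =
      (fun x => ((fun x => F x * wt V x) \_ `]-oo, a]) x - ((fun x => F x * wt V x) \_ [set a]) x).
    by rewrite z; apply/funext => x /=; rewrite addrK.
  by rewrite e intRB// Il I1 subr0.
have N1 : (1 : R) ^+ 2 = 1 by rewrite expr1n.
have N2 : (-1 : R) ^+ 2 = 1 by rewrite sqrrN expr1n.
have [u [hu zu ru]] := node_test sV iwt hF hP LF r0 Fa N1 right ss s0 s1 s01 ds0 (wt_side_gt0 a N1).
have [v [hv zv rv]] := node_test sV iwt hF hP LF r0 Fa N2 left ss s0 s1 s01 ds0 (wt_side_gt0 a N2).
have u0 : 0 < nrm2 V u by rewrite -(pmulr_rgt0 _ r0) (le_lt_trans _ ru)// nrm2_ge0.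
have v0 : 0 < nrm2 V v by rewrite -(pmulr_rgt0 _ r0) (le_lt_trans _ rv)// nrm2_ge0.
pose rho := Num.max (nrm2 V (derive1 u) / nrm2 V u) (nrm2 V (derive1 v) / nrm2 V v).
have rr : rho < r by rewrite /rho gt_max; apply/andP; split; rewrite ltr_pdivrMr.
have uv x : u x * v x = 0 /\ derive1 u x * derive1 v x = 0.
  have [xa|/ltW xa] := leP (x - a) 0.
    by have [|-> ->] := zu x; rewrite ?mul1r ?mul0r.
  by have [|-> ->] := zv x; rewrite ?mulN1r ?oppr_le0 ?mulr0.
have ru' : nrm2 V (derive1 u) <= rho * nrm2 V u by rewrite -ler_pdivrMr// /rho le_max lexx.
have rv' : nrm2 V (derive1 v) <= rho * nrm2 V v by rewrite -ler_pdivrMr// /rho le_max lexx orbT.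
have h := lam1_le sV hu hv (fun x => (uv x).1) (fun x => (uv x).2) u0 v0 ru' rv'.
by move: h; rewrite lr lee_fin leNgt rr.
Qed.

Lemma first_eigenfunction r : 0 < r -> lam V 1 = r%:E -> disc_spec V r ->
  exists F P, [/\ has_deriv F (fun x => P x / wt V x),
    has_deriv P (fun x => - r * (F x * wt V x)), L2 V F,
    L2 V (fun x => P x / wt V x) & (forall x, 0 < P x)].
Proof.
move=> r0 lr [[f [[g [[Lf [Lg [phi [hphi [cf cg]]]]] eig]] nf]] _].
have [F [P [hF hP LF nF [LP rF PE]]]] := eigen_regular sV iwt Lf Lg hphi cf cg eig.
have F1 : intR (fun x => F x * wt V x) = 0.
  by apply/eqP; move/eqP: rF; rewrite mulf_eq0 gt_eqF.
have nF0 : nrm2 V F != 0.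
  apply: contra nf => /eqP nF'; have LfF := L2B cV Lf LF.
  have := nrm2_ge0 V (fun x => (f x - F x) - F x).
  have e : f = fun x => (f x - F x) - (-1) * F x by apply/funext => x; ring.
  have LNF := L2Z cV (-1) LF.
  move=> _; rewrite eq_le nrm2_ge0 andbT {1}e.
  apply: (le_trans (nrm2B_le cV LfF LNF)); rewrite nF /nrm2.
  by rewrite (ipZl cV _ LF LNF) (ipZr cV _ LF LF) -/(nrm2 V F) nF' !mulr0 addr0.
(* Were all approximants zero, [f] would have norm 0. The nonzero one is the seed of the cutoffs. *)
have [k [x0 pk]] : exists k x0, phi k x0 != 0.
  apply: contrapT => H; move/negP: nf; apply; apply/eqP.
  have z k : phi k = fun=> 0.
    apply/funext => x; apply/eqP; apply: contrapT => /negP hx; apply: H.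
    by exists k, x.
  have e : (fun k => nrm2 V (fun x => phi k x - f x)) = fun=> nrm2 V f.
    apply/funext => k; rewrite /nrm2 !ipE; congr (_ / _); apply: intR_ext => x.
    by rewrite z; ring.
  rewrite e in cf; apply: (cvg_unique (@Rhausdorff R) (@cvg_cst _ (nrm2 V f) _ \oo _) cf).
have P0 a := eigen_no_node a hF hP LF r0 lr (hphi k) pk nF0 F1 PE.
have cP : continuous P := has_deriv_cont hP.
have [P00|P00] := ltP 0 (P 0).
  exists F, P; split => // x; rewrite ltNge; apply/negP => Px.
  have [x0'|/ltW x0'] := leP 0 x.
    have [||c _ /eqP] := @IVT R P 0 x 0 x0'.
    - exact: continuous_subspaceT.
    - by rewrite ge_min le_max Px (ltW P00) orbT.
    - by apply/negP; exact: P0.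
  have [||c _ /eqP] := @IVT R P x 0 0 x0'.
  - exact: continuous_subspaceT.
  - by rewrite ge_min le_max Px (ltW P00) orbT.
  - by apply/negP; exact: P0.
exists (fun x => -1 * F x), (fun x => -1 * P x); split.
- by apply: has_deriv_eq (has_derivZ (-1) hF) _ _ => // x; rewrite mulrA.
- by apply: has_deriv_eq (has_derivZ (-1) hP) _ _ => // x; ring.
- exact: L2Z.
- have h := L2Z cV (-1) LP.
  by rewrite (_ : (fun x => _) = fun x => -1 * (P x / wt V x))//; apply/funext => x; rewrite mulrA.
move=> x; rewrite mulN1r oppr_gt0 ltNge; apply/negP => Px.
have [x0'|/ltW x0'] := leP 0 x.
  have [||c _ /eqP] := @IVT R P 0 x 0 x0'.
  - exact: continuous_subspaceT.
  - by rewrite ge_min le_max Px P00 orbT.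
  - by apply/negP; exact: P0.
have [||c _ /eqP] := @IVT R P x 0 0 x0'.
- exact: continuous_subspaceT.
- by rewrite ge_min le_max Px P00 orbT.
- by apply/negP; exact: P0.
Qed.

End Monotone.

(** * The gap above the first eigenvalue *)

Section SecondGap.
Variable R : realType.
Variable V : R -> R.
Hypothesis sV : smooth V.
Hypothesis iwt : integrableR (wt V).
Variables (F P : R -> R) (r kappa : R).
Hypothesis hF : has_deriv F (fun x => P x / wt V x).
Hypothesis hP : has_deriv P (fun x => - r * (F x * wt V x)).
Hypothesis LF : L2 V F.
Hypothesis LP : L2 V (fun x => P x / wt V x).
Hypothesis P0 : forall x, 0 < P x.
Hypothesis r0 : 0 < r.
Hypothesis k0 : 0 < kappa.
Hypothesis hW : forall x, 2 * kappa ^+ 2 <= derive1n 2 (Wfun V) x.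

Let cV : continuous V. Proof. exact: smooth_cont. Qed.
Let cwt : continuous (wt V). Proof. exact: continuous_wt. Qed.
Let Zc0 : Zc V != 0. Proof. by rewrite gt_eqF// Zc_gt0. Qed.
Let wt0 x : wt V x != 0. Proof. by rewrite gt_eqF// wt_gt0. Qed.
Let Pn0 x : P x != 0. Proof. by rewrite gt_eqF. Qed.
Let cF : continuous F. Proof. exact: has_deriv_cont hF. Qed.
Let cP : continuous P. Proof. exact: has_deriv_cont hP. Qed.

(* The ground state of the Schroedinger operator with potential [Wfun V], and minus its logarithmic
   derivative. *)
Let psi x := P x * ewt V x.
Let h x := r * (F x * wt V x / P x) - derive1 V x / 2.

Let psi0 x : 0 < psi x. Proof. by rewrite /psi mulr_gt0// ewt_gt0. Qed.

Let dpsi : has_deriv psi (fun x => - h x * psi x).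
Proof.
apply: has_deriv_eq (has_derivM hP (ewt_deriv sV)) _ _ => // x.
by have p0 := Pn0 x; rewrite /h /psi; field.
Qed.

Let dh : has_deriv h (fun x => h x ^+ 2 - (Wfun V x - r)).
Proof.
have d1 := has_derivM (has_derivM hF (wt_deriv sV)) (has_derivV hP Pn0).
have d2 := has_derivD (has_derivZ r d1) (has_derivZ (- 2^-1) (smooth_deriv2 sV)).
apply: has_deriv_eq d2 _ _ => x; first by rewrite /h; field; exact: Pn0.
by have p0 := Pn0 x; have w0 := wt0 x; rewrite /h /Wfun; field; rewrite w0 p0.
Qed.

Let psi2 x : psi x ^+ 2 = (P x / wt V x) ^+ 2 * wt V x.
Proof.
have w0 := wt0 x; rewrite /psi exprMn.
transitivity (P x ^+ 2 / wt V x * (ewt V x ^+ 2 * wt V x)); first by field.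
by rewrite ewt2; field.
Qed.

Let h_ge x : kappa <= h x ^+ 2 - (Wfun V x - r).
Proof.
have sW := W_smooth sV.
have dG : has_deriv (fun x => Wfun V x - r) (derive1 (Wfun V)).
  apply: has_deriv_eq (has_derivD (smooth_deriv sW) (has_deriv_cst (- r))) _ _ => // t.
  by rewrite addr0.
apply: (riccati_lower_bound k0 dpsi dh dG (smooth_deriv2 sW) hW psi0).
apply: integrableR_ext (L2_int cV LP) => t.
by rewrite psi2.
Qed.

Let ch : continuous h. Proof. exact: has_deriv_cont dh. Qed.

(* With [D = d/dx + h] the Schroedinger operator is [D^* D + r], while [D D^*] is at least
   [2 * kappa] because [h' >= kappa]; [y] solves [u = - D^* y]. *)
Let key_ineq f z : cc f -> has_deriv z (fun x => f x * wt V x) -> cc z ->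
  intR (fun x => F x * (f x * wt V x)) = 0 ->
  (r + 2 * kappa) * intR (fun x => z x ^+ 2 / wt V x) <= intR (fun x => f x ^+ 2 * wt V x).
Proof.
move=> hf hz cz orth.
pose u x := ewt V x * z x.
pose u' x := derive1 V x / 2 * u x + ewt V x * (f x * wt V x).
have du : has_deriv u u' := conj_deriv sV hz.
have ccu : cc u := cc_conj sV cz.
have ccu' : cc u' := cc_conj' sV hf cz.
have -> : (fun x => z x ^+ 2 / wt V x) = fun x => u x ^+ 2.
  by apply/funext => x; rewrite conj_sqr.
rewrite (conj_energy sV hf hz cz) -/u -/u'.
have cu := cc_cont ccu; have cu' := cc_cont ccu'; have cW := W_cont sV.
have chu : cc (fun x => h x * u x) by exact: ccM.
pose D x := u' x + h x * u x.
have ccD' : cc D by exact: ccD.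
have cD := cc_cont ccD'.
have iu2 := integrable_cc (ccX2 ccu); have iD2 := integrable_cc (ccX2 ccD').
(* By the Riccati equation [dh], the two integrands differ by the derivative of [h * u ^ 2]. *)
have E1 : intR (fun x => u' x ^+ 2 + Wfun V x * u x ^+ 2) =
    r * intR (fun x => u x ^+ 2) + intR (fun x => D x ^+ 2).
  rewrite -intRZ// -intRD//; last exact: integrableRZ.
  have c1 : cc (fun x => u' x ^+ 2 + Wfun V x * u x ^+ 2).
    by apply: ccD; [exact: ccX2|exact: ccM cW (ccX2 ccu)].
  have c2 : cc (fun x => r * u x ^+ 2 + D x ^+ 2).
    by apply: ccD; [exact: ccZ (ccX2 ccu)|exact: ccX2].
  apply/eqP; rewrite -subr_eq0 -intRB; [|exact: integrable_cc..].
  apply/eqP; apply: (@intR_deriv0 _ (fun x => -1 * (h x * u x ^+ 2))).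
  - apply: has_deriv_eq (has_derivZ (-1) (has_derivM dh (has_derivX2 du))) _ _ => // x.
    by rewrite /D; ring.
  - exact: ccB.
  - by have [] := ccZ (-1) (ccM ch (ccX2 ccu)).
(* [zF] is [psi * u], because [ewt ^ 2] is the inverse of [wt]. Integrating by parts, orthogonality
   of [f] to [F] becomes orthogonality of [u] to the ground state [psi], which is the solvability
   condition for [y] with compact support. *)
pose zF x := z x * (P x / wt V x).
have cPw : continuous (fun x => P x / wt V x) by exact: contM cP (continuous_invwt sV).
have cczF : cc zF by exact: ccMr.
have I0 : intR zF = 0.
  have ifF : integrableR (fun x => F x * (f x * wt V x)).
    by apply: integrable_cc; exact: ccM cF (ccMr hf cwt).
  suff : intR zF + intR (fun x => F x * (f x * wt V x)) = 0 by rewrite orth addr0.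
  rewrite -intRD//; last exact: integrable_cc.
  apply: (@intR_deriv0 _ (fun x => F x * z x)).
  - apply: has_deriv_eq (has_derivM hF hz) _ _ => // x.
    by rewrite /zF; ring.
  - by apply: ccD => //; exact: ccM cF (ccMr hf cwt).
  - by have [] := ccM cF cz.
have [Y [dY ccY]] := cc_primitive cczF I0.
(* Variation of constants: [(psi * y)' = psi * u] is equivalent to [y' = u + h * y]. *)
pose y x := Y x / psi x.
have dpsiV := has_derivV dpsi (fun x => lt0r_neq0 (psi0 x)).
have cpsiV := has_deriv_cont dpsiV.
have ccy : cc y by exact: ccMr.
have cy := cc_cont ccy.
have dy : has_deriv y (fun x => u x + h x * y x).
  apply: has_deriv_eq (has_derivM dY dpsiV) _ _ => // x.
  have p0 := Pn0 x; have w0 := wt0 x; have e0 : ewt V x != 0 by rewrite gt_eqF// ewt_gt0.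
  rewrite /y /zF /u.
  have -> : z x * (P x / wt V x) / psi x = ewt V x * z x.
    transitivity (z x * (ewt V x ^+ 2 * wt V x) / (ewt V x * wt V x)).
      by rewrite ewt2 /psi; field; rewrite w0 e0 p0.
    by field; rewrite w0 e0.
  by field; rewrite lt0r_neq0.
have iy2 := integrable_cc (ccX2 ccy).
have iuy : cc (fun x => D x * y x) by exact: ccM.
have E2 : 2 * kappa * intR (fun x => y x ^+ 2) <= intR (fun x => u x ^+ 2).
  (* Here [u] is [y' - h * y] and [u + 2 * h * y] is [y' + h * y]: the commutator of D and its
     adjoint, evaluated on [y]. The difference [q - u ^ 2] is the derivative of [2 * h * y ^ 2]. *)
  pose q x := (u x + 2 * h x * y x) ^+ 2 + 2 * (h x ^+ 2 - (Wfun V x - r)) * y x ^+ 2.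
  have ccq : cc q.
    apply: ccD.
      apply: ccX2; apply: ccD => //; apply: ccM => //; exact: contZ.
    apply: ccM; last exact: ccX2.
    apply: contZ; apply: contD; first exact: contX2.
    have cWr : continuous (fun x => Wfun V x - r) by apply: contD => // x; exact: cvg_cst.
    by move=> x; apply: cvgN; exact: cWr.
  have -> : intR (fun x => u x ^+ 2) = intR q.
    apply/eqP; rewrite -subr_eq0 -intRB//; last exact: integrable_cc.
    apply/eqP; apply: (@intR_deriv0 _ (fun x => -2 * (h x * y x ^+ 2))).
    - apply: has_deriv_eq (has_derivZ (-2) (has_derivM dh (has_derivX2 dy))) _ _ => // x.
      by rewrite /q; ring.
    - by apply: ccB => //; exact: ccX2.
    - by have [] := ccZ (-2) (ccM ch (ccX2 ccy)).
  rewrite -intRZ//; apply: le_intR; [exact: integrableRZ|exact: integrable_cc|].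
  move=> x; rewrite /q; apply: ler_wpDl; first exact: sqr_ge0.
  apply: ler_wpM2r; first exact: sqr_ge0.
  by apply: ler_wpM2l => //; exact: h_ge.
have E3 : intR (fun x => u x ^+ 2) = - intR (fun x => D x * y x).
  apply/eqP; rewrite -addr_eq0 -intRD//; last exact: integrable_cc.
  apply/eqP; apply: (@intR_deriv0 _ (fun x => u x * y x)).
  - apply: has_deriv_eq (has_derivM du dy) _ _ => // x.
    by rewrite /D; ring.
  - by apply: ccD => //; exact: ccX2.
  - by have [] := ccM cu ccy.
have E4 := intR_CS iD2 iy2 (integrable_cc iuy).
rewrite E1 mulrDl lerD2l.
set U := intR (fun x => u x ^+ 2) in E2 E3 E4 *.
set D2 := intR (fun x => D x ^+ 2) in E4 *.
set Y2 := intR (fun x => y x ^+ 2) in E2 E4.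
have D20 : 0 <= D2 by apply: intR_ge0 => x; exact: sqr_ge0.
have U0 : 0 <= U by apply: intR_ge0 => x; exact: sqr_ge0.
have E5 : U ^+ 2 <= D2 * Y2 by rewrite E3 sqrrN.
have [->|Un] := eqVneq U 0; first by rewrite mulr0.
have Up : 0 < U by rewrite lt_neqAle eq_sym Un.
rewrite -(ler_pM2r Up); apply: (@le_trans _ _ (2 * kappa * (D2 * Y2))).
  rewrite -(mulrA (2 * kappa) U U) -expr2; apply: ler_wpM2l => //.
  by rewrite mulr_ge0// ltW.
by rewrite mulrCA; apply: ler_wpM2l.
Qed.

(** Constraining by 1 and [F] is the same as by 1 and [F0 = F - c0]. The shift makes [F0] orthogonal
    to [hat], so that [hat] and [hat * F0] are, up to scaling, biorthogonal to 1 and [F0], as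
    [lam_ge] demands. *)
Lemma lam2_ge : ((r + 2 * kappa)%:E <= lam V 2)%E.
Proof.
have L1 : L2 V (fun=> 1) by exact: L2_cst.
have Lh : L2 V (@hat R) by apply: L2_cc => //; exact: cc_hat.
have i0 : 0 < ip V (@hat R) (fun=> 1).
  rewrite ipE divr_gt0 ?Zc_gt0//; apply: (@intR_gt0 _ _ 0).
  - apply: contM => //; apply: contM; first exact: cc_cont (@cc_hat R).
    by move=> x; exact: cvg_cst.
  - exact: L2_mul.
  - by move=> x; rewrite mulr1 mulr_ge0 ?wt_ge0 ?hat_ge0.
  - by rewrite mulr1 mulr_gt0 ?wt_gt0 ?hat0.
pose c0 := ip V (@hat R) F / ip V (@hat R) (fun=> 1).
pose F0 x := F x - c0 * 1.
have Lc : L2 V (fun=> c0 * 1) by exact: L2_cst.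
have LF0 : L2 V F0 by exact: L2B.
have cF0 : continuous F0 by apply: contD => // x; exact: cvg_cst.
pose hF0 x := @hat R x * F0 x.
have cchF0 : cc hF0 by exact: ccMr (@cc_hat R) cF0.
have LhF0 : L2 V hF0 by exact: L2_cc.
have N0 : 0 < ip V hF0 F0.
  (* [F] is strictly increasing because [P > 0], so [F0] cannot vanish at both 0 and 1 / 2, where
     [hat] is positive. *)
  have [a [ha Fa]] : exists a, 0 < @hat R a /\ F0 a != 0.
    have [e|e] := eqVneq (F0 0) 0; last by exists 0; rewrite hat0.
    exists (1 / 2); split; first by apply: hat_gt0; lra.
    rewrite -e gt_eqF// /F0 ltrD2r; apply: (deriv_gt0_lt (fun x _ => hF x)); last by lra.
    by move=> x _; rewrite divr_gt0// wt_gt0.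
  rewrite ipE divr_gt0 ?Zc_gt0//; apply: (@intR_gt0 _ _ a).
  - by apply: contM => //; apply: contM => //; exact: cc_cont.
  - exact: L2_mul.
  - by move=> x; rewrite /hF0 -(mulrA (hat x)) -expr2 mulr_ge0 ?wt_ge0// mulr_ge0 ?sqr_ge0 ?hat_ge0.
  - by rewrite /hF0 -(mulrA (hat a)) -expr2 mulr_gt0 ?wt_gt0// mulr_gt0// exprn_even_gt0.
have ort : ip V (@hat R) F0 = 0.
  rewrite /F0 (ipBr cV LF Lc Lh) (ipZr cV _ L1 Lh) /c0 divfK ?subrr//.
  by rewrite gt_eqF.
have ort' : ip V hF0 (fun=> 1) = 0.
  by rewrite -ort !ipE; congr (_ / _); apply: intR_ext => x; rewrite mulr1.
apply: (@lam_ge _ _ sV iwt 2 _ (fun i => if i is 0%N then fun=> 1 else F0)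
  (fun i => if i is 0%N then fun x => (ip V (@hat R) (fun=> 1))^-1 * hat x
            else fun x => (ip V hF0 F0)^-1 * hF0 x)).
- by case.
- by case=> [|i] _; apply: ccZ => //; exact: cc_hat.
- case=> [|[|//]] [|[|//]] _ _ /=.
  + by rewrite (ipZl cV _ Lh L1) mulVf// gt_eqF.
  + by rewrite (ipZl cV _ Lh LF0) ort mulr0.
  + by rewrite (ipZl cV _ LhF0 L1) ort' mulr0.
  + by rewrite (ipZl cV _ LhF0 LF0) mulVf// gt_eqF.
move=> f hf fg; have f1 := fg 0%N isT; have f2 := fg 1%N isT; rewrite /= in f1 f2.
have Lf := L2_cc cV hf.
have fw : cc (fun x => f x * wt V x) by exact: ccMr.
have fF : ip V f F = 0.
  by move: f2; rewrite /F0 (ipBr cV LF Lc Lf) (ipZr cV _ L1 Lf) f1 mulr0 subr0.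
have [|z [hz cz]] := cc_primitive fw.
  move: f1; rewrite ipE => /eqP; rewrite mulf_eq0 invr_eq0 (negbTE Zc0) orbF => /eqP <-.
  by apply: intR_ext => x; rewrite mulr1.
apply: (duality_ineq sV iwt hf hz cz); first by rewrite addr_ge0 ?mulr_ge0 ?ltW.
apply: key_ineq => //.
move: fF; rewrite ipE => /eqP; rewrite mulf_eq0 invr_eq0 (negbTE Zc0) orbF => /eqP <-.
by apply: intR_ext => x; ring.
Qed.

End SecondGap.

Theorem mainTheorem12 (R : realType) (V : R -> R) (kappa : R) :
  smooth V ->
  (\int[@lebesgue_measure R]_x ((wt V x)%:E) < +oo)%E ->
  (exists r : R, lam V 1 = r%:E /\ disc_spec V r) ->
  0 < kappa ->
  (forall x : R, 2 * kappa ^+ 2 <= derive1n 2 (Wfun V) x) ->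
  ((2 * kappa)%:E <= lam V 2 - lam V 1)%E.
Proof.
move=> sV iV [r [lr dr]] k0 hW.
have iwt : integrableR (wt V).
  have cV := smooth_cont sV.
  apply/integrableP; split; first by apply/measurable_EFinP; exact: measurable_wt.
  apply: le_lt_trans iV; rewrite le_eqVlt; apply/orP; left; apply/eqP.
  by apply: eq_integral => x _ /=; rewrite ger0_norm// wt_ge0.
have [c c0 hc] := lam1_gt0 sV iwt k0 hW.
have r0 : 0 < r by move: hc; rewrite lr lee_fin; exact: lt_le_trans.
have [F [P [hF hP LF LP P0]]] := first_eigenfunction sV iwt r0 lr dr.
have := lam2_ge sV iwt hF hP LF LP P0 r0 k0 hW.
by rewrite lr leeBrDr// -EFinD addrC.
Qed.
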